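(* Let $K$ be an algebraically closed field of characteristic $0$, $n\in\mathbb{N}$, let $\widetilde Z\subseteq\mathbb{P}^n_K$ be a projective (closed sub)scheme, assume $p=(1:0:\cdots:0)\in\mathbb{P}^n_K\setminus\widetilde Z$, and let $\pi:\widetilde Z\twoheadrightarrow Z\subseteq\mathbb{P}^{n-1}_K$ be the outer simple linear projection from $p$. Let $G$ be a finite Gröbner basis of $I_{\widetilde Z}$ with respect to an elimination ordering, and let $k\in\mathbb{N}$. Then the sets $D_g$, for $g\in G^\circ_{x_0,k}$, form a finite affine covering of $Z_k^\circ$ (i.e. they are finitely many affine open subsets of $Z_k^\circ$ whose union is $Z_k^\circ$). Moreover, for all $g\in G^\circ_{x_0,k}$, all $q\in D_g$ and all partitions $\lambda$ of $k$, $$q\in Z_\lambda^\circ\iff g\!\upharpoonright_q\,\in X_\lambda^\circ .$$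
   Context: Notation. $\mathbb{N}$ denotes the positive integers. $R=K[x_0,\dots,x_n]$ is the homogeneous coordinate ring of $\mathbb{P}^n_K$; the homogeneous ideal of $p=(1:0:\cdots:0)$ is $\mathfrak{p}=\langle x_1,\dots,x_n\rangle$, and $S:=K[x_1,\dots,x_n]\subset R$. The simple linear projection $\mathbb{P}^n_K\setminus\{p\}\to\mathbb{P}^{n-1}_K=\mathrm{Proj}(S)$ is given by the inclusion $S\hookrightarrow R$; $\pi$ is its restriction to $\widetilde Z$ and $Z$ is the image of $\widetilde Z$. $I_{\widetilde Z}\subseteq R$ is the saturated homogeneous ideal with $\widetilde Z=\mathrm{Proj}(R/I_{\widetilde Z})$. An elimination ordering is a monomial ordering on $R$ in which every monomial divisible by $x_0$ is greater than every monomial in $K[x_1,\dots,x_n]$. The Gröbner basis $G$ consists of homogeneous elements. Fibers. For a closed point $q\in Z$ let $\mathfrak{q}\subset S$ be its homogeneous ideal. The projective line $\langle q,p\rangle=\mathbb{P}^1_K$ spanned by $q$ and $p$ is $\mathrm{Proj}(R/\mathfrak{q}R)$. The fiber $\pi^{-1}(q)=\widetilde Z\cap\langle q,p\rangle$ is a closed subscheme of finite length of $\langle q,p\rangle$, hence an effective divisor on $\mathbb{P}^1_K$; its length is the degree of this divisor. For $k\in\mathbb{N}$, $Z_k^\circ$ is the set of closed points $q\in Z$ such that $\pi^{-1}(q)$ has length exactly $k$ (a locally closed set). Partitions. A partition of $k$ is a family $\lambda=(\lambda_1,\dots,\lambda_e)$ of positive integers with $\lambda_1+\dots+\lambda_e=k$.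 $Z_\lambda^\circ$ is the set of closed points $q\in Z$ such that $\pi^{-1}(q)=\sum_{i=1}^e\lambda_i\widetilde q_i$ as divisors, with distinct closed points $\widetilde q_1,\dots,\widetilde q_e\in\langle q,p\rangle$. Polynomials in $x_0$. $R=S[x_0]$; for $g\in R$, $\deg_{x_0}(g)$ and $\mathrm{LC}_{x_0}(g)\in S$ are its degree and leading coefficient as a polynomial in $x_0$ over $S$. $G^\circ_{x_0,k}:=\{g\in G\mid\deg_{x_0}(g)=k\}$. For such $g$, $D_g:=Z_k^\circ\setminus V(\mathrm{LC}_{x_0}(g))$ is the set of points of $Z_k^\circ$ at which $\mathrm{LC}_{x_0}(g)$ does not vanish. Restriction. For a closed point $q\in Z$ fix a linear form $y\in S_1\setminus\mathfrak{q}$; then $S/\mathfrak{q}=K[y]$ and $R/\mathfrak{q}R=K[x_0,y]$. $g\!\upharpoonright_q$ denotes the class of $g$ in $R/\mathfrak{q}R=K[x_0,y]$. If $g=\sum_{i=0}^kg_ix_0^{k-i}$ with $g_i\in S$ is homogeneous of total degree $t$, then $g_i+\mathfrak{q}=\bar g_i\,y^{t-k+i}$ with $\bar g_i\in K$, and $g\!\upharpoonright_q$ is regarded as the binary form $\sum_{i=0}^k\bar g_ix_0^{k-i}y^i$ of degree $k$, i.e. as the point $(\bar g_0:\dots:\bar g_k)\in\mathbb{P}^k_K$. Coincident root loci. A point $(a_0:\dots:a_k)\in\mathbb{P}^k_K$ is identified with the binary form $\sum_{j=0}^ka_jx_0^{k-j}y^j$ up to a nonzero scalar. For a partition $\lambda=(\lambda_1,\dots,\lambda_e)$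 of $k$, $X_\lambda\subseteq\mathbb{P}^k_K$ is the projective variety of binary forms that can be written as $\prod_{i=1}^eL_i^{\lambda_i}$ with linear forms $L_1,\dots,L_e\in K[x_0,y]_1$ (not necessarily distinct), and $X_\lambda^\circ\subseteq X_\lambda$ is the open subset of those for which $L_1,\dots,L_e$ can be chosen pairwise non-proportional.
   Formalization: Affineness of D_g is asserted only if LC_{x_0}(g) is nonconstant or Z_k° is finite; otherwise D_g = Z_k° is an infinite closed subset of projective space, hence not affine (e.g. Z̃ = V(x_0) in P^2, G = {x_0}, k = 1, D_g = P^1). *)

(* Defs.v *)
From mathcomp Require Import all_boot all_order all_algebra.
From mathcomp Require Import mpoly.

Set Implicit Arguments.
Unset Strict Implicit.
Unset Printing Implicit Defensive.

Import GRing.Theory.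
Local Open Scope ring_scope.

(* Closed points of P^(m-1) are given by nonzero rows in K^m, up to [same_point];
   a subset of P^(m-1) is a predicate on rows that holds of nonzero rows only
   and respects [same_point]. *)
Section Projective.
Variables (K : closedFieldType) (m : nat).
Implicit Types (u v : 'rV[K]_m) (X D C : 'rV[K]_m -> Prop).

Definition same_point u v := exists2 c : K, c != 0 & u = c *: v.

Definition vanish (A : {mpoly K[m]} -> Prop) v :=
  v != 0 /\ forall f, A f -> f.@[v 0] = 0.

Definition proj_closed C :=
  exists A : {mpoly K[m]} -> Prop,
    (forall f, A f -> f \is homog mdeg) /\ (forall v, C v <-> vanish A v).

Definition open_in X D :=
  exists2 C, proj_closed C & forall v, D v <-> X v /\ ~ C v.

Definition locally_closed X :=
  exists2 C, proj_closed C & open_in C X.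

Definition proj_finite X :=
  exists s : seq 'rV[K]_m, forall v, X v -> exists2 u, u \in s & same_point v u.

(* Near every point of [X], [phi] is a quotient of two forms of equal degree. *)
Definition regular_fun X (phi : 'rV[K]_m -> K) :=
  forall v, X v -> exists d (a b : {mpoly K[m]}),
    [/\ a \is d.-homog, b \is d.-homog, b.@[v 0] != 0 &
        forall u, X u -> b.@[u 0] != 0 -> phi u = a.@[u 0] / b.@[u 0]].

Definition affine_closed N (Y : 'rV[K]_N -> Prop) :=
  exists A : {mpoly K[N]} -> Prop, forall z, Y z <-> forall f, A f -> f.@[z 0] = 0.

(* Near every point of [Y], [psi] is given by [m] polynomials without common
   zeros. *)
Definition regular_to_proj N (Y : 'rV[K]_N -> Prop) (psi : 'rV[K]_N -> 'rV[K]_m) :=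
  forall z, Y z -> exists (F : 'I_m -> {mpoly K[N]}) (c : {mpoly K[N]}),
    c.@[z 0] != 0 /\
    forall w, Y w -> c.@[w 0] != 0 -> same_point (psi w) (\row_i (F i).@[w 0]).

(* A quasi-projective variety is affine if it is isomorphic, as a variety, to a
   closed subset of some A^N. *)
Definition affine_variety X :=
  locally_closed X /\
  exists N (Y : 'rV[K]_N -> Prop)
         (phi : 'rV[K]_m -> 'rV[K]_N) (psi : 'rV[K]_N -> 'rV[K]_m),
    [/\ affine_closed Y,
        (forall v, X v -> Y (phi v)) /\ (forall z, Y z -> X (psi z)),
        (forall v, X v -> same_point (psi (phi v)) v) /\
        (forall z, Y z -> phi (psi z) = z),
        forall i, regular_fun X (fun v => phi v 0 i) &
        regular_to_proj Y psi].

End Projective.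

Section Ideals.
Variables (K : closedFieldType) (m : nat).
Implicit Types (A I : {mpoly K[m]} -> Prop) (f g : {mpoly K[m]}).

Definition ideal_gen A f :=
  exists s : seq ({mpoly K[m]} * {mpoly K[m]}),
    (forall u, u \in s -> A u.2) /\ f = \sum_(u <- s) u.1 * u.2.

(* [1] may belong to [I]: the unit ideal is the saturated ideal of the empty
   scheme. *)
Definition is_ideal I :=
  [/\ I 0, (forall f g, I f -> I g -> I (f + g)) & (forall f g, I g -> I (f * g))].

Definition homogeneous_ideal I := forall d f, I f -> I (pihomog mdeg d f).

Definition saturation I f :=
  exists N, forall a : 'X_{1..m}, mdeg a = N -> I ('X_[a] * f).

Definition saturated I := forall f, saturation I f -> I f.

Definition monomial_ordering (le : rel 'X_{1..m}) :=
  [/\ antisymmetric le, transitive le, total le,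
      (forall a b c, le a b -> le (a + c)%MM (b + c)%MM) &
      (forall a, le 0%MM a)].

Definition leading_term (le : rel 'X_{1..m}) f (t : {mpoly K[m]}) :=
  exists a, [/\ a \in msupp f, (forall b, b \in msupp f -> le b a)
              & t = f@_a *: 'X_[a]].

Definition leading_ideal (le : rel 'X_{1..m}) A :=
  ideal_gen (fun t => exists2 f, A f & leading_term le f t).

Definition groebner_basis (le : rel 'X_{1..m}) I (G : seq {mpoly K[m]}) :=
  (forall g, g \in G -> I g) /\
  (forall f, leading_ideal le I f <-> leading_ideal le (fun g => g \in G) f).

Lemma ideal_gen_ideal A : is_ideal (ideal_gen A).
Proof.
split.
- by exists [::]; rewrite big_nil.
- move=> f g [s [hs ->]] [t [ht ->]]; exists (s ++ t); rewrite big_cat; split=> // u.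
  by rewrite mem_cat => /orP[/hs|/ht].
- move=> f g [s [hs ->]]; exists [seq (f * u.1, u.2) | u <- s]; split.
    by move=> u /mapP[w /hs hw ->].
  by rewrite big_map mulr_sumr; apply: eq_bigr => u _; rewrite mulrA.
Qed.
Lemma ideal_gen_sub A f : A f -> ideal_gen A f.
Proof.
move=> Af; exists [:: (1, f)]; rewrite big_seq1 mul1r; split=> // u.
by rewrite inE => /eqP ->.
Qed.

End Ideals.

(* R = K[x_0, ..., x_n] is {mpoly K[n.+1]}, x_0 being 'X_ord0;
   S = K[x_1, ..., x_n] is {mpoly K[n]}, x_(j+1) being 'X_j.
   In K[x_0, y] = {mpoly K[2]}, x_0 is 'X_ord0 and y is 'X_ord_max. *)
Section OuterProjection.
Variables (K : closedFieldType) (n : nat).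
Implicit Types (I : {mpoly K[n.+1]} -> Prop) (g : {mpoly K[n.+1]}).
Implicit Types (q : 'rV[K]_n) (lam : seq nat).

Definition elimination_ordering (le : rel 'X_{1..n.+1}) :=
  monomial_ordering le /\
  forall a b : 'X_{1..n.+1}, (0 < a ord0)%N -> b ord0 = 0%N -> le b a.

(* The isomorphism R = S[x_0]. *)
Definition x0poly g : {poly {mpoly K[n]}} :=
  mmap (polyC \o @mpolyC n K)
       (fun i => if unlift ord0 i is Some j then ('X_j)%:P else 'X) g.

Definition x0lc g : {mpoly K[n]} := lead_coef (x0poly g).

(* The elements of [G] of degree exactly [k] in x_0. *)
Definition x0part (G : seq {mpoly K[n.+1]}) (k : nat) : seq {mpoly K[n.+1]} :=
  [seq g <- G | size (x0poly g) == k.+1].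

Definition center : 'rV[K]_n.+1 := delta_mx 0 ord0.

Definition projection (v : 'rV[K]_n.+1) : 'rV[K]_n := \row_j v 0 (lift ord0 j).

Definition image I q :=
  q != 0 /\ exists2 v, vanish I v & same_point (projection v) q.

(* The inclusion of S in R. *)
Definition embS (f : {mpoly K[n]}) : {mpoly K[n.+1]} :=
  f \mPo [tuple 'X_(lift ord0 j) | j < n].

(* The ideal qR, for the homogeneous ideal of a point [q] of P^(n-1). *)
Definition point_ideal_ext q : {mpoly K[n.+1]} -> Prop :=
  ideal_gen (fun h => exists f, [/\ f \is homog mdeg, f.@[q 0] = 0 & h = embS f]).

(* The quotient map R -> R/qR = K[x_0, y], for the linear form y in S/q = K[y]
   with y(q) = 1 at the chosen row [q]: the class of h in S_d is h(q) y^d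
   (see [line_class_embS], [line_class_ker]).  Geometrically, it identifies the line <q, p> with
   P^1 through (s : t) |-> s p + t q. *)
Definition line_class q g : {mpoly K[2]} :=
  g \mPo [tuple if unlift ord0 i is Some j then q 0 j *: 'X_ord_max else 'X_ord0
         | i < n.+1].

Definition fiber_ideal I q (f : {mpoly K[2]}) :=
  exists2 g, I g & f = line_class q g.

(* The linear form on P^1 that vanishes at (s : t). *)
Definition point_form (v : 'rV[K]_2) : {mpoly K[2]} :=
  v 0 ord_max *: 'X_ord0 - v 0 ord0 *: 'X_ord_max.

(* The fiber over [q] is the divisor \sum_i lam_i pts_i, with distinct pts_i:
   the two closed subschemes of P^1 have the same saturated ideal. *)
Definition fiber_eq_divisor I q lam (pts : 'I_(size lam) -> 'rV[K]_2) :=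
  [/\ forall i, pts i != 0,
      forall i j, i != j -> ~ same_point (pts i) (pts j) &
      forall f, saturation (fiber_ideal I q) f <->
        exists h, f = h * \prod_(i < size lam) point_form (pts i) ^+ nth 0%N lam i].

Definition is_partition lam (k : nat) := all (leq 1) lam /\ sumn lam = k.

(* Z_lambda° *)
Definition Zpart I lam q :=
  image I q /\ exists pts, @fiber_eq_divisor I q lam pts.

(* Z_k°: the fiber is an effective divisor of degree [k]. *)
Definition Zlen I (k : nat) q :=
  image I q /\ exists2 lam, is_partition lam k & exists pts, @fiber_eq_divisor I q lam pts.

(* D_g *)
Definition Dset I (k : nat) g q := Zlen I k q /\ (x0lc g).@[q 0] != 0.

Definition mon2 (a b : nat) : 'X_{1..2} := [multinom if i == ord0 then a else b | i < 2].

(* The coordinates of g|_q in P^k, for [g] of degree [k] in x_0 and a linear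
   form [y] of S with y(q) != 0; [y] takes the value 1 at y(q)^-1 q.  The i-th one
   is g_i(q) / y(q)^(deg g - k + i), see [restrictionE]. *)
Definition restriction (k : nat) (y : {mpoly K[n]}) q g : 'rV[K]_k.+1 :=
  \row_i (line_class ((y.@[q 0])^-1 *: q) g)@_(mon2 (k - i) ((msize g).-1 - k + i)).

Lemma line_classX0 q : line_class q 'X_ord0 = 'X_ord0.
Proof. by rewrite /line_class comp_mpolyXU -tnth_nth tnth_mktuple unlift_none. Qed.
Lemma line_classXS q j : line_class q 'X_(lift ord0 j) = q 0 j *: 'X_ord_max.
Proof. by rewrite /line_class comp_mpolyXU -tnth_nth tnth_mktuple liftK. Qed.

Lemma line_class_embS q d (f : {mpoly K[n]}) :
  f \is d.-homog -> line_class q (embS f) = f.@[q 0] *: 'X_ord_max ^+ d.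
Proof.
move=> hf; rewrite mevalE scaler_suml /embS comp_mpolyEX /line_class raddf_sum /=.
rewrite [LHS]big_seq [RHS]big_seq; apply: eq_bigr => m hm.
rewrite comp_mpolyZ comp_mpolyX rmorph_prod /= -scalerA; congr (_ *: _).
have <- : mdeg m = d by exact: (dhomogP _ _ _ hf).
rewrite mdegE -prodrXr -scaler_prod; apply: eq_bigr => j _.
by rewrite tnth_mktuple rmorphXn /= [X in X ^+ _]line_classXS exprZn.
Qed.

Lemma line_class_ker q g : q != 0 ->
  line_class q g = 0 <-> point_ideal_ext q g.
Proof.
move=> q0; split; last first.
  case=> s [hs ->]; rewrite /line_class raddf_sum /= big_seq big1 // => u /hs.
  case=> f [/homogP[d hf] f0 ->]; rewrite rmorphM /= [X in _ * X](line_class_embS _ hf).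
  by rewrite f0 scale0r mulr0.
have [j qj] : exists j, q 0 j != 0.
  apply/existsP; apply: contraNT q0; rewrite negb_exists => /forallP h.
  by apply/eqP/rowP => j; rewrite mxE; apply/eqP; rewrite -[_ == _]negbK.
pose y0 : {mpoly K[n.+1]} := (q 0 j)^-1 *: 'X_(lift ord0 j).
pose sg (f : {mpoly K[2]}) := f \mPo [tuple if i == ord0 then 'X_ord0 else y0 | i < 2].
have [I0 ID IM] := ideal_gen_ideal (fun h => exists f : {mpoly K[n]},
   [/\ f \is homog mdeg, f.@[q 0] = 0 & h = embS f]).
rewrite -/(point_ideal_ext q) in I0 ID IM.
have IN h : point_ideal_ext q h -> point_ideal_ext q (- h) by rewrite -mulN1r; apply: IM.
suff H h : point_ideal_ext q (h - sg (line_class q h)).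
  by move=> g0; have := H g; rewrite g0 /sg comp_mpoly0 subr0.
have HM h1 h2 : point_ideal_ext q (h1 - sg (line_class q h1)) ->
    point_ideal_ext q (h2 - sg (line_class q h2)) ->
    point_ideal_ext q (h1 * h2 - sg (line_class q (h1 * h2))).
  move=> H1 H2; rewrite /sg /line_class !rmorphM /=.
  rewrite -/(line_class q h1) -/(line_class q h2) -/(sg _) -/(sg (line_class q h2)).
  have -> : h1 * h2 - sg (line_class q h1) * sg (line_class q h2) =
     h1 * (h2 - sg (line_class q h2)) + sg (line_class q h2) * (h1 - sg (line_class q h1)).
    rewrite !mulrBr [h1 * sg _]mulrC addrA subrK; congr (_ - _); exact: mulrC.
  by apply: ID; apply: IM.
have H1 : point_ideal_ext q (1 - sg (line_class q 1)).
  by rewrite /sg /line_class !comp_mpoly1 subrr.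
have HX i : point_ideal_ext q ('X_i - sg (line_class q 'X_i)).
  case: (unliftP ord0 i) => [l ->|->]; last first.
    by rewrite line_classX0 /sg comp_mpolyXU -tnth_nth tnth_mktuple eqxx subrr.
  rewrite line_classXS /sg comp_mpolyZ comp_mpolyXU -tnth_nth tnth_mktuple /=.
  apply: ideal_gen_sub; exists ('X_l - (q 0 l * (q 0 j)^-1) *: 'X_j); split.
  - by apply/homogP; exists 1%N; rewrite rpredB ?rpredZ ?dhomogX /= ?mdeg1.
  - by rewrite mevalB mevalZ !mevalXU divfK ?subrr.
  - rewrite /embS comp_mpolyB comp_mpolyZ !comp_mpolyXU -!tnth_nth !tnth_mktuple.
    by rewrite /y0 scalerA.
have HE i e : point_ideal_ext q ('X_i ^+ e - sg (line_class q ('X_i ^+ e))).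
  by elim: e => [|e IH]; rewrite ?expr0 // exprS; apply: HM.
have HP m : point_ideal_ext q ('X_[m] - sg (line_class q 'X_[m])).
  rewrite mpolyXE_id; elim/big_ind: _ => // i _; exact: HE.
have HC c : point_ideal_ext q (c%:MP - sg (line_class q c%:MP)).
  by rewrite /sg /line_class !comp_mpolyC subrr.
rewrite [h]mpolyE.
apply: (big_ind (fun h => point_ideal_ext q (h - sg (line_class q h)))) => [|h1 h2 H2 H3|m _].
- exact: HC 0.
- by rewrite /sg /line_class !comp_mpolyD opprD addrACA; apply: ID.
- by rewrite -mul_mpolyC; apply: HM.
Qed.


Lemma x0poly_coef g e : (x0poly g)`_e =
  \sum_(m <- msupp g) (g@_m *+ (m ord0 == e)) *: \prod_(j < n) 'X_j ^+ m (lift ord0 j).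
Proof.
rewrite /x0poly /mmap coef_sum; apply: eq_bigr => m _.
rewrite /mmap1 big_ord_recl unlift_none.
under eq_bigr => l _ do rewrite liftK -rmorphXn.
rewrite -rmorph_prod /= mulrCA -rmorphM mulrC /= coefCM coefXn eq_sym.
by case: eqP; rewrite ?mulr1 ?mulr0 ?scale0r // mul_mpolyC.
Qed.

Lemma restrictionE k (y : {mpoly K[n]}) q g :
  y.@[q 0] != 0 -> g \is homog mdeg -> size (x0poly g) = k.+1 ->
  forall i : 'I_k.+1, restriction k y q g 0 i =
    ((x0poly g)`_(k - i)%N).@[q 0] / y.@[q 0] ^+ ((msize g).-1 - k + i)%N.
Proof.
move=> y0 hg sg i; rewrite mxE; set t := (msize g).-1.
have hd : g \is t.-homog by move: hg => /homogP[d hd]; apply: dhomog_msize hd.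
have dS (m : 'X_{1..n.+1}) : mdeg m = (m ord0 + \sum_(l < n) m (lift ord0 l))%N.
  by rewrite mdegE big_ord_recl.
have kt : (k <= t)%N.
  rewrite leqNgt; apply/negP => tk.
  have : (x0poly g)`_k = 0.
    rewrite x0poly_coef big_seq big1 // => m hm.
    have mt : mdeg m = t by exact: (dhomogP _ _ _ hd).
    case: eqP => e; last by rewrite scale0r.
    by move: tk; rewrite -mt dS e ltnNge leq_addr.
  by apply/eqP; have := lead_coef_eq0 (x0poly g); rewrite lead_coefE sg /= -size_poly_eq0 sg => ->.
rewrite /line_class comp_mpolyEX raddf_sum /= x0poly_coef raddf_sum /= mulr_suml.
rewrite [LHS]big_seq [RHS]big_seq; apply: eq_bigr => m hm.
have dm : mdeg m = t by exact: (dhomogP _ _ _ hd).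
rewrite mcoeffZ comp_mpolyX big_ord_recl tnth_mktuple unlift_none.
rewrite (eq_bigr (fun l : 'I_n => ((y.@[q 0])^-1 * q 0 l) ^+ m (lift ord0 l) *:
    ('X_ord_max : {mpoly K[2]}) ^+ m (lift ord0 l))); last first.
  by move=> l _; rewrite tnth_mktuple liftK exprZn mxE.
rewrite scaler_prod prodrXr -scalerAr mcoeffZ !mpolyXn -mpolyXD mcoeffX.
have -> : ((U_(ord0) *+ m ord0 + U_(ord_max) *+ \sum_(l < n) m (lift ord0 l))%MM ==
   mon2 (k - i) (t - k + i)) = (m ord0 == k - i)%N.
  apply/eqP/eqP => [/mnmP/(_ ord0)|e].
    by rewrite mnmDE !mulmnE !mnm1E !mnmE eqxx (_ : (ord_max == ord0) = false) // mul1n mul0n addn0.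
  apply/mnmP => l; rewrite mnmDE !mulmnE !mnm1E !mnmE.
  have [->|l0] := eqVneq l ord0.
    by rewrite (_ : (ord_max == ord0) = false) // mul1n mul0n addn0.
  have -> : l = ord_max by apply/val_inj; case: l l0 => [[|[]]].
  rewrite eqxx mul0n mul1n add0n.
  have ik : (i <= k)%N by rewrite -ltnS.
  apply: (@addnI (m ord0)); rewrite -dS dm e.
  by rewrite addnCA -[(k - i + i)%N]/(k - i + i)%N subnK // subnK.
rewrite mevalZ rmorph_prod /= mulrb; case: eqP => e; last by rewrite !mulr0 !mul0r.
rewrite mulr1 -mulrA; congr (_ * _).
under eq_bigr => l _ do rewrite exprMn.
rewrite big_split /= prodrXr mulrC; congr (_ * _).
  by apply: eq_bigr => l _; rewrite rmorphXn /= mevalXU.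
rewrite exprVn; congr (_ ^+ _)^-1.
have ik : (i <= k)%N by rewrite -ltnS.
by apply: (@addnI (m ord0)); rewrite -dS dm e addnCA subnK // subnK.
Qed.

End OuterProjection.

Section CoincidentRootLoci.
Variables (K : closedFieldType) (k : nat).

Definition binary_form (a : 'rV[K]_k.+1) : {mpoly K[2]} :=
  \sum_(j < k.+1) a 0 j *: 'X_[mon2 (k - j) j].

(* X_lambda° *)
Definition Xpart (lam : seq nat) (a : 'rV[K]_k.+1) :=
  a != 0 /\
  exists (L : 'I_(size lam) -> {mpoly K[2]}) (c : K),
    [/\ forall i, L i \is 1.-homog,
        forall i j, i != j -> ~ exists b : K, L i = b *: L j,
        c != 0 &
        binary_form a = c *: \prod_(i < size lam) L i ^+ nth 0%N lam i].

End CoincidentRootLoci.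

(* Main.v *)
Require Import Defs.
From mathcomp Require Import all_boot all_order all_algebra.
From mathcomp Require Import mpoly.

(** Specialization at a point q of P^(n-1) turns a polynomial g of R = S[x_0] into a
    polynomial [spec q g] in x_0 over K; it is the restriction of g to the line <q, p>,
    read in the chart y = 1.  The fiber over q is cut out on that line by the
    specializations of the elements of I, and everything rests on knowing a single
    generator of them.

    The generator comes from an idea of Gianni and Kalkbrener.  Let g0 in I have
    the smallest x_0-degree k among the elements of I whose leading x_0-coefficient does
    not vanish at q.  Pseudo-division by g0 shows that it suffices to treat f in I of
    x_0-degree < k, and such an f specializes to 0: otherwise, multiplying by x_0 and
    reducing modulo g0, one could raise the degree of the specialization while keeping the
    x_0-degree below k, until one got an element of I of x_0-degree k - 1 that survives
    at q ([map_poly_low], [map_poly_dvd]).  For an elimination ordering, leading monomials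
    have maximal x_0-degree, so division by G shows that g0 can be taken in G
    ([groebner_lc], [fiber_generator]).

    Since p is not on the scheme, I contains a form with an x_0^D-term.  Hence the ideal
    of the fiber contains x_0^D modulo y, saturating it amounts to inverting y, and the
    saturation is generated by the homogenization of [spec q g0] ([fiber_saturation]).  So
    the fiber has length k, and its type lambda is the list of root multiplicities
    of [spec q g0] ([fiber_divisor_root_type]).  This gives the covering at once: q lies in
    Z_k° exactly when the minimal x_0-degree at q is k, and then the corresponding
    element of G is some g with q in D_g.  Conversely any g of x_0-degree k in G with q
    in D_g specializes to a polynomial of the minimal degree, hence to a generator.  The
    restriction of g in P^k is its specialization up to scaling x_0 and the polynomial
    itself, and membership in X_lambda° only depends on root multiplicities ([XpartE]).

    Finally D_g is the complement of the hypersurface LC(g) = 0 in the closed set where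
    the leading coefficients of smaller x_0-degree vanish.  A hypersurface complement of
    degree d > 0 becomes a closed subset of an affine space under the d-th Veronese
    embedding ([affine_complement]). *)

Set Implicit Arguments.
Unset Strict Implicit.
Unset Printing Implicit Defensive.

Import GRing.Theory.
Local Open Scope ring_scope.

(** * Binary forms and their dehomogenizations *)

Section BinaryForms.
Variable K : closedFieldType.
Implicit Types (f g : {mpoly K[2]}) (p : {poly K}) (d e : nat).

(** Setting y := 1. *)
Definition dehom : {mpoly K[2]} -> {poly K} :=
  mmap polyC (fun i : 'I_2 => if i == ord0 then 'X else 1).

Definition homogenize d p : {mpoly K[2]} :=
  \sum_(i < d.+1) p`_i *: ('X_ord0 ^+ i * 'X_ord_max ^+ (d - i)).

Lemma dehomM f g : dehom (f * g) = dehom f * dehom g.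
Proof. exact: rmorphM. Qed.

Lemma dehomB f g : dehom (f - g) = dehom f - dehom g.
Proof. exact: raddfB. Qed.

Lemma dehomXn f i : dehom (f ^+ i) = dehom f ^+ i.
Proof. exact: rmorphXn. Qed.

Lemma dehom_sum (T : Type) (r : seq T) (P : pred T) (F : T -> {mpoly K[2]}) :
  dehom (\sum_(i <- r | P i) F i) = \sum_(i <- r | P i) dehom (F i).
Proof. exact: raddf_sum. Qed.

Lemma dehomZ c f : dehom (c *: f) = c *: dehom f.
Proof. by rewrite /dehom mmapZ mul_polyC. Qed.

Lemma dehomX0 : dehom 'X_ord0 = 'X.
Proof. by rewrite /dehom mmapX mmap1U. Qed.

Lemma dehomX1 : dehom 'X_ord_max = 1.
Proof. by rewrite /dehom mmapX mmap1U. Qed.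

Lemma mdeg2 (m : 'X_{1..2}) : mdeg m = (m ord0 + m ord_max)%N.
Proof.
rewrite mdegE big_ord_recl big_ord_recl big_ord0 addn0; congr (_ + m _)%N.
exact/val_inj.
Qed.

Lemma mpolyX2 (m : 'X_{1..2}) :
  'X_[m] = 'X_ord0 ^+ m ord0 * 'X_ord_max ^+ m ord_max :> {mpoly K[2]}.
Proof.
rewrite [LHS]mpolyXE_id big_ord_recl big_ord_recl big_ord0 mulr1.
by congr (_ * 'X_ _ ^+ m _); apply/val_inj.
Qed.

Lemma dehomXm (m : 'X_{1..2}) : dehom 'X_[m] = 'X^(m ord0).
Proof. by rewrite mpolyX2 dehomM !dehomXn dehomX0 dehomX1 expr1n mulr1. Qed.

Lemma homogenize_homog d p : homogenize d p \is d.-homog.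
Proof.
rewrite rpred_sum // => i _; rewrite rpredZ //.
have hX (j : 'I_2) l : ('X_j : {mpoly K[2]}) ^+ l \is l.-homog.
  by rewrite -[X in X.-homog]mul1n; apply: dhomogMn; rewrite dhomogX /= mdeg1.
have /subnKC id : (i <= d)%N by rewrite -ltnS.
by rewrite -[X in _ \in X.-homog]id; apply: dhomogM; apply: hX.
Qed.

Lemma homogenizeK d f : f \is d.-homog -> homogenize d (dehom f) = f.
Proof.
move=> /dhomogP hf; rewrite [in RHS](mpolyE f) [in LHS](mpolyE f) dehom_sum /homogenize.
under eq_bigr => i _ do rewrite coef_sum scaler_suml.
rewrite exchange_big big_seq [RHS]big_seq; apply: eq_bigr => m hm.
have dm : mdeg m = d by exact: hf.
have md : (m ord0 < d.+1)%N by rewrite ltnS -dm mdeg2 leq_addr.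
rewrite (bigD1 (Ordinal md)) //= big1 ?addr0 => [|i].
  by rewrite dehomZ coefZ dehomXm coefXn eqxx mulr1 (mpolyX2 m) -dm mdeg2 addKn.
rewrite -val_eqE /= => ne; rewrite dehomZ coefZ dehomXm coefXn (negPf ne).
by rewrite mulr0 scale0r.
Qed.

Lemma size_dehom d f : f \is d.-homog -> (size (dehom f) <= d.+1)%N.
Proof.
move=> /dhomogP hf; rewrite (mpolyE f) dehom_sum big_seq.
apply: leq_trans (size_sum _ _ _) _; apply/bigmax_leqP_seq => m _ mf.
rewrite dehomZ dehomXm; apply: leq_trans (size_scale_leq _ _) _.
have dm : mdeg m = d by exact: hf.
by rewrite size_polyXn ltnS -dm mdeg2 leq_addr.
Qed.

Lemma dehomK d p : (size p <= d.+1)%N -> dehom (homogenize d p) = p.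
Proof.
move=> sp; apply/polyP => j; rewrite dehom_sum coef_sum.
under eq_bigr => i _ do
  rewrite dehomZ dehomM !dehomXn dehomX0 dehomX1 expr1n mulr1 coefZ coefXn.
case: (ltnP j d.+1) => jd.
  rewrite (bigD1 (Ordinal jd)) //= eqxx mulr1 big1 ?addr0 // => i.
  by rewrite -val_eqE /= eq_sym => /negPf ->; rewrite mulr0.
rewrite nth_default ?(leq_trans sp) // big1 // => i _.
by rewrite gtn_eqF ?mulr0 // (leq_trans _ jd).
Qed.

Lemma dehom_inj d f g :
  f \is d.-homog -> g \is d.-homog -> dehom f = dehom g -> f = g.
Proof. by move=> /homogenizeK {2}<- /homogenizeK {2}<- ->. Qed.

(** On a binary form whose restriction to y = 1 keeps full degree, that is, which
    does not vanish at (1 : 0), divisibility can be tested at y = 1. *)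
Lemma homogenize_divp d e f g :
  f \is d.-homog -> g \is e.-homog -> size (dehom g) = e.+1 ->
  dehom g %| dehom f -> f = homogenize (d - e) (dehom f %/ dehom g) * g.
Proof.
move=> hf hg sg dv; have [f0|f0] := eqVneq f 0.
  rewrite f0 [dehom 0]raddf0 div0p /homogenize big1 ?mul0r // => i _.
  by rewrite coef0 scale0r.
have df0 : dehom f != 0.
  apply: contraNneq f0 => f0; apply/eqP/(dehom_inj hf (dhomog0 _ _ d)).
  by rewrite f0 [RHS]raddf0.
have ed : (e <= d)%N.
  by rewrite -ltnS -sg; apply: leq_trans (size_dehom hf); apply: dvdp_leq.
apply: (@dehom_inj d) => //.
  by rewrite -{2}(subnK ed); apply: dhomogM => //; apply: homogenize_homog.
rewrite dehomM dehomK ?divpK //.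
rewrite size_divp -?size_poly_eq0 ?sg //= -subSn // leq_sub2r //.
exact: size_dehom.
Qed.

End BinaryForms.

(** * Polynomials in x_0 and their specializations at a point *)

Section Specialization.
Variables (K : closedFieldType) (n : nat).
Implicit Types (f g h : {mpoly K[n.+1]}) (s : {mpoly K[n]}) (q : 'rV[K]_n).

(** The isomorphism R = S[x_0] behind an opaque equality, so that its values at two
    polynomials are compared without unfolding the ring structure of S[x_0]. *)
Fact x0poly_seal : {xp : {mpoly K[n.+1]} -> {poly {mpoly K[n]}} | xp = @x0poly K n}.
Proof. by exists (@x0poly K n). Qed.

Definition xpoly := sval x0poly_seal.
Definition xlc g := lead_coef (xpoly g).

Lemma xpolyE : xpoly = @x0poly K n. Proof. exact: svalP x0poly_seal. Qed.
Lemma xlcE g : xlc g = x0lc g. Proof. by rewrite /xlc xpolyE. Qed.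

Lemma xpoly_coef g e : (xpoly g)`_e =
  \sum_(m <- msupp g) (g@_m *+ (m ord0 == e)) *: \prod_(j < n) 'X_j ^+ m (lift ord0 j).
Proof. by rewrite xpolyE x0poly_coef. Qed.

Lemma xpolyM f g : xpoly (f * g) = xpoly f * xpoly g.
Proof. rewrite xpolyE; exact: rmorphM. Qed.

Lemma xpolyXn f i : xpoly (f ^+ i) = xpoly f ^+ i.
Proof. rewrite xpolyE; exact: rmorphXn. Qed.

Lemma xpolyB f g : xpoly (f - g) = xpoly f - xpoly g.
Proof. rewrite xpolyE; exact: raddfB. Qed.

Lemma xpoly0 : xpoly 0 = 0.
Proof. rewrite xpolyE; exact: raddf0. Qed.

Lemma xpoly_sum (T : Type) (r : seq T) (P : pred T) (F : T -> {mpoly K[n.+1]}) :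
  xpoly (\sum_(i <- r | P i) F i) = \sum_(i <- r | P i) xpoly (F i).
Proof. rewrite xpolyE; exact: raddf_sum. Qed.

Lemma xpoly_prod (T : Type) (r : seq T) (P : pred T) (F : T -> {mpoly K[n.+1]}) :
  xpoly (\prod_(i <- r | P i) F i) = \prod_(i <- r | P i) xpoly (F i).
Proof. rewrite xpolyE; exact: rmorph_prod. Qed.

Lemma xpolyZ c f : xpoly (c *: f) = c%:MP%:P * xpoly f.
Proof. by rewrite xpolyE /x0poly mmapZ. Qed.

Lemma xpolyX0 : xpoly ('X_ord0 : {mpoly K[n.+1]}) = 'X.
Proof. by rewrite xpolyE /x0poly mmapX mmap1U unlift_none. Qed.

Lemma xpolyXS j : xpoly ('X_(lift ord0 j) : {mpoly K[n.+1]}) = ('X_j)%:P.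
Proof. by rewrite xpolyE /x0poly mmapX mmap1U liftK. Qed.

Lemma xpolyXm (m : 'X_{1..n.+1}) :
  xpoly ('X_[m] : {mpoly K[n.+1]}) =
    'X^(m ord0) * ('X_[[multinom m (lift ord0 j) | j < n]])%:P.
Proof.
rewrite xpolyE /x0poly mmapX /mmap1 big_ord_recl unlift_none; congr (_ * _).
rewrite mpolyXE_id rmorph_prod /=; apply: eq_bigr => j _.
by rewrite liftK mnmE rmorphXn.
Qed.

Lemma xpoly_embS s : xpoly (embS s) = s%:P.
Proof.
rewrite /embS comp_mpolyEX xpoly_sum [in RHS](mpolyE s) rmorph_sum /=.
apply: eq_bigr => m _; rewrite xpolyZ comp_mpolyX -mul_mpolyC polyCM.
congr (_ * _); rewrite mpolyXE_id rmorph_prod xpoly_prod.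
by apply: eq_bigr => j _; rewrite tnth_mktuple xpolyXn xpolyXS rmorphXn.
Qed.

(** No cancellation occurs between monomials, so that x_0-degrees can be read off the
    support. *)
Lemma xpoly_mcoeff g e (m : 'X_{1..n}) :
  ((xpoly g)`_e)@_m = g@_[multinom if unlift ord0 i is Some j then m j else e | i < n.+1].
Proof.
rewrite [in LHS](mpolyE g) xpoly_sum coef_sum [LHS]raddf_sum /= [in RHS](mpolyE g).
rewrite [RHS]raddf_sum; apply: eq_bigr => a _ /=.
rewrite xpolyZ xpolyXm coefCM mulrC coefMC coefXn mcoeffZ mcoeffX mulrC mcoeffCM.
congr (_ * _); have -> : (a == [multinom if unlift ord0 i is Some j then m j else e | i < n.+1])
    = (e == a ord0) && ([multinom a (lift ord0 j) | j < n] == m).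
  apply/eqP/andP => [->|[/eqP-> /eqP<-]].
    rewrite mnmE unlift_none; split=> //; apply/eqP/mnmP => j.
    by rewrite !mnmE liftK.
  by apply/mnmP => i; rewrite mnmE; case: unliftP => [j ->|->]; rewrite ?mnmE.
by case: eqP => _; rewrite ?mul1r ?mul0r ?mcoeffX ?mcoeff0.
Qed.

Lemma size_xpoly_leP g k :
  reflect {in msupp g, forall m : 'X_{1..n.+1}, (m ord0 < k)%N} (size (xpoly g) <= k)%N.
Proof.
apply: (iffP idP) => [/leq_sizeP sg m mg|sg].
  rewrite ltnNge; apply: contraL mg => /sg g0; rewrite mcoeff_msupp negbK.
  have := xpoly_mcoeff g (m ord0) [multinom m (lift ord0 j) | j < n].
  rewrite g0 mcoeff0 => /esym/eqP; congr (g@__ == 0); apply/mnmP => i.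
  by rewrite mnmE; case: unliftP => [j ->|->]; rewrite ?mnmE.
apply/leq_sizeP => j kj; rewrite xpoly_coef big_seq big1 // => m /sg mk.
by rewrite ltn_eqF ?scale0r // (leq_trans mk kj).
Qed.

Definition spec q g : {poly K} := map_poly (meval (q 0)) (xpoly g).

Lemma spec_sum q (T : Type) (r : seq T) (P : pred T) (F : T -> {mpoly K[n.+1]}) :
  spec q (\sum_(i <- r | P i) F i) = \sum_(i <- r | P i) spec q (F i).
Proof. by rewrite /spec xpoly_sum rmorph_sum. Qed.

Lemma specZ q c f : spec q (c *: f) = c *: spec q f.
Proof. by rewrite /spec xpolyZ rmorphM /= map_polyC /= mevalC mul_polyC. Qed.

Lemma coef_spec q g i : (spec q g)`_i = ((xpoly g)`_i).@[q 0].
Proof. exact: coef_map. Qed.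

Lemma size_spec q g : (xlc g).@[q 0] != 0 -> size (spec q g) = size (xpoly g).
Proof. by move=> h; rewrite /spec size_map_poly_id0. Qed.

Lemma specXm q (m : 'X_{1..n.+1}) :
  spec q 'X_[m] = (\prod_(j < n) q 0 j ^+ m (lift ord0 j)) *: 'X^(m ord0).
Proof.
rewrite /spec xpolyXm rmorphM /= map_polyC /= map_polyXn mulrC mul_polyC.
by congr (_ *: _); rewrite mevalX; apply: eq_bigr => j _; rewrite mnmE.
Qed.

Lemma line_class_Xm q (m : 'X_{1..n.+1}) :
  line_class q 'X_[m] = (\prod_(j < n) q 0 j ^+ m (lift ord0 j)) *:
    ('X_ord0 ^+ m ord0 * 'X_ord_max ^+ (\sum_(j < n) m (lift ord0 j))%N).
Proof.
rewrite /line_class comp_mpolyX big_ord_recl tnth_mktuple unlift_none.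
rewrite scalerAr; congr (_ * _); rewrite -prodrXr -scaler_prod.
by apply: eq_bigr => j _; rewrite tnth_mktuple liftK exprZn.
Qed.

Lemma line_classM q f g : line_class q (f * g) = line_class q f * line_class q g.
Proof. exact: rmorphM. Qed.

Lemma line_classXn q f i : line_class q (f ^+ i) = line_class q f ^+ i.
Proof. exact: rmorphXn. Qed.

Lemma line_classZ q c f : line_class q (c *: f) = c *: line_class q f.
Proof. exact: comp_mpolyZ. Qed.

Lemma line_classD q f g : line_class q (f + g) = line_class q f + line_class q g.
Proof. exact: raddfD. Qed.

Lemma line_class_sum q (T : Type) (r : seq T) (P : pred T) (F : T -> {mpoly K[n.+1]}) :
  line_class q (\sum_(i <- r | P i) F i) = \sum_(i <- r | P i) line_class q (F i).
Proof. exact: raddf_sum. Qed.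

Lemma dehom_line_class q g : dehom (line_class q g) = spec q g.
Proof.
rewrite (mpolyE g) line_class_sum dehom_sum spec_sum; apply: eq_bigr => m _.
rewrite line_classZ dehomZ specZ line_class_Xm specXm dehomZ dehomM !dehomXn.
by rewrite dehomX0 dehomX1 expr1n mulr1.
Qed.

Lemma line_class_homog q d g : g \is d.-homog -> line_class q g \is d.-homog.
Proof.
move=> /dhomogP hg; rewrite (mpolyE g) line_class_sum big_seq rpred_sum // => m mg.
have dm : mdeg m = d by exact: hg.
rewrite line_classZ rpredZ // line_class_Xm rpredZ //.
have hX (j : 'I_2) l : ('X_j : {mpoly K[2]}) ^+ l \is l.-homog.
  by rewrite -[X in X.-homog]mul1n; apply: dhomogMn; rewrite dhomogX /= mdeg1.
by rewrite -dm mdegE big_ord_recl; apply: dhomogM; apply: hX.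
Qed.

Lemma horner_spec q g r :
  (spec q g).[r] = g.@[fun i => if unlift ord0 i is Some j then q 0 j else r].
Proof.
rewrite (mpolyE g) spec_sum horner_sum rmorph_sum; apply: eq_bigr => m _ /=.
rewrite specZ specXm !hornerZ hornerXn mevalZ mevalX big_ord_recl unlift_none.
by congr (_ * _); rewrite mulrC; congr (_ * _); apply: eq_bigr => j _; rewrite liftK.
Qed.

End Specialization.

(** * Specialization of an ideal is governed by its smallest surviving degree *)

Section SpecializationTheorem.
Variables (S : comNzRingType) (K : fieldType) (ev : {rmorphism S -> K}).
Variables (J : {poly S} -> Prop) (g0 : {poly S}).
Implicit Types (f g : {poly S}).
Hypotheses (JB : forall f g, J f -> J g -> J (f - g)).
Hypotheses (JM : forall f g, J g -> J (f * g)).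
Hypotheses (Jg0 : J g0) (lc_g0 : ev (lead_coef g0) != 0).
Hypothesis g0_min : forall f, J f -> (size f < size g0)%N -> ev (lead_coef f) = 0.

Local Notation "f ^ev" := (map_poly ev f) (at level 2, format "f ^ev").

(** Replacing f by lc(g0) X f - c g0, where c is the coefficient of f just below the
    degree of g0, keeps the degree below that of g0 and multiplies the specialization
    by X, since c specializes to 0.  So a nonzero specialization could be raised until
    its degree equals that of f, where [g0_min] forbids it. *)
Lemma map_poly_low f : J f -> (size f < size g0)%N -> f^ev = 0.
Proof.
have [k kE] : exists k, size g0 = k.+1.
  exists (size g0).-1; rewrite prednK // size_poly_gt0.
  by apply: contraNneq lc_g0 => ->; rewrite lead_coef0 rmorph0.
rewrite kE ltnS => If sf; apply/eqP; apply: contraT; rewrite -size_poly_gt0 => sp.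
have szev h : (size h^ev <= size h)%N by exact: size_poly.
have [m] : exists m, (size f^ev + m = k)%N.
  by exists (k - size f^ev)%N; rewrite subnKC // (leq_trans (szev _)).
elim: m => [|m IH] in f If sf sp *.
  rewrite addn0 => sk; have sx : size f = k.
    by apply/eqP; rewrite eqn_leq sf -sk szev.
  have : lead_coef f^ev != 0 by rewrite lead_coef_eq0 -size_poly_gt0.
  by rewrite lead_coefE coef_map sk -sx -lead_coefE /= g0_min ?eqxx // kE sx.
move=> sm; have k0 : (0 < k)%N by rewrite -sm addnS.
have hb : ev f`_k.-1 = 0.
  by rewrite -coef_map nth_default // -ltnS prednK // -sm addnS ltnS leq_addr.
pose f' := (lead_coef g0)%:P * ('X * f) - (f`_k.-1)%:P * g0.
have sf' : f'^ev = ev (lead_coef g0) *: ('X * f^ev).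
  by rewrite rmorphB !rmorphM /= map_polyX !map_polyC /= hb mul0r subr0 mul_polyC.
have ss : size f'^ev = (size f^ev).+1.
  by rewrite sf' size_scale // mulrC size_mulX // -size_poly_gt0.
apply: (IH f'); rewrite ?ss ?addSnnS //.
  by apply: JB; do ?apply: JM.
apply/leq_sizeP => j kj; rewrite coefB !coefCM coefXM (gtn_eqF (leq_trans k0 kj)).
move: kj; rewrite leq_eqVlt => /predU1P[<-|kj].
  by rewrite lead_coefE kE mulrC subrr.
have -> : f`_j.-1 = 0 by apply: nth_default; apply: leq_trans sf _; case: j kj.
by rewrite [g0`_j]nth_default ?kE // !mulr0 subr0.
Qed.

(** Pseudo-division by [g0] reduces to [map_poly_low], because the leading coefficient
    of [g0] becomes invertible. *)
Theorem map_poly_dvd f : J f -> g0^ev %| f^ev.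
Proof.
have [m] := ubnP (size f); elim: m f => // m IH f sm If.
have [sg|sg] := ltnP (size f) (size g0).
  by rewrite (map_poly_low If sg) dvdp0.
have g0p : (0 < size g0)%N.
  by rewrite size_poly_gt0; apply: contraNneq lc_g0 => ->; rewrite lead_coef0 rmorph0.
have fp : (0 < size f)%N := leq_trans g0p sg.
pose d := (size f - size g0)%N.
pose f' := (lead_coef g0)%:P * f - ((lead_coef f)%:P * 'X^d) * g0.
have If' : J f' by apply: JB; apply: JM.
have sf' : (size f' < size f)%N.
  rewrite -[X in (_ < X)%N](prednK fp) ltnS; apply/leq_sizeP => j.
  rewrite /f' -mulrA coefB !coefCM coefXnM.
  rewrite leq_eqVlt => /predU1P[<-|fj].
    have dp : (d <= (size f).-1)%N by rewrite -ltnS prednK // ltn_subrL g0p.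
    rewrite ltnNge dp /= -[f`_(_).-1]lead_coefE.
    have -> : ((size f).-1 - d)%N = (size g0).-1.
      by rewrite -!subn1 subnAC subKn.
    by rewrite -lead_coefE mulrC subrr.
  rewrite nth_default ?mulr0; last by rewrite -(prednK fp).
  rewrite ltnNge; case: leqP => [dj|_] /=; last by rewrite mulr0 subr0.
  rewrite nth_default ?mulr0 ?subr0 // leq_subRL // /d subnK //.
  by rewrite -(prednK fp).
have := IH f' (leq_trans sf' sm) If'.
have -> : f'^ev = ev (lead_coef g0) *: f^ev - ((lead_coef f)%:P * 'X^d)^ev * g0^ev.
  by rewrite rmorphB !rmorphM /= map_polyC mul_polyC.
by rewrite addrC dvdp_addr ?dvdpNr ?dvdp_mull // dvdpZr.
Qed.

End SpecializationTheorem.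

(** * Elimination Groebner bases specialize well *)

Section MonomialOrderings.
Variables (K : closedFieldType) (n : nat) (le : rel 'X_{1..n.+1}).
Hypothesis elim_le : elimination_ordering le.
Implicit Types (a b c : 'X_{1..n.+1}) (f g : {mpoly K[n.+1]}).

(** Dividing two comparable monomials by the common power of x_0 gives a pair to which
    the elimination property applies. *)
Lemma elimination_x0deg a b : le a b -> (a ord0 <= b ord0)%N.
Proof.
case: elim_le => [[anti _ _ addle _] elim] ab; rewrite leqNgt; apply/negP => ba.
have low c : (c - U_(ord0) *+ b ord0)%MM ord0 = (c ord0 - b ord0)%N.
  by rewrite mnmBE mulmnE mnm1E eqxx mul1n.
have split c : (b ord0 <= c ord0)%N ->
    (c - U_(ord0) *+ b ord0 + U_(ord0) *+ b ord0 = c)%MM.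
  move=> bc; apply: submK; apply/mnm_lepP => i; rewrite mulmnE mnm1E.
  by case: eqP => [<-|_]; rewrite ?mul1n ?mul0n.
have := elim (a - U_(ord0) *+ b ord0)%MM (b - U_(ord0) *+ b ord0)%MM.
rewrite !low subnn subn_gt0 => /(_ ba erefl)/(addle _ _ (U_(ord0) *+ b ord0)%MM).
rewrite !split ?(ltnW ba) // => ble; have eab : a = b by apply: anti; rewrite ab.
by rewrite eab ltnn in ba.
Qed.

Lemma leading_monomial f : f != 0 ->
  exists2 a, a \in msupp f & forall b, b \in msupp f -> le b a.
Proof.
case: elim_le => [[_ tr tot _ _] _]; rewrite -msupp_eq0.
elim: (msupp f) => // a [|a' s] IH _.
  by exists a; rewrite ?inE // => b; rewrite inE => /eqP->; case/orP: (tot a a).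
case: IH => // c cs cmax; have [ac|ca] := orP (tot a c).
  exists c; first by rewrite inE cs orbT.
  by move=> b; rewrite inE => /predU1P[->//|/cmax].
exists a; first by rewrite inE eqxx.
move=> b; rewrite inE => /predU1P[->|/cmax bc]; first by case/orP: (tot a a).
exact: tr bc ca.
Qed.

Lemma size_xpoly_leading f a : a \in msupp f -> (forall b, b \in msupp f -> le b a) ->
  size (xpoly f) = (a ord0).+1.
Proof.
move=> af amax; apply/eqP; rewrite eqn_leq; apply/andP; split.
  by apply/size_xpoly_leP => b /amax/elimination_x0deg; rewrite ltnS.
by rewrite ltnNge; apply/negP => /size_xpoly_leP/(_ a af); rewrite ltnn.
Qed.

End MonomialOrderings.

(** The coefficient of x_0^d in a form of degree d is a constant, and every other
    monomial vanishes at p. *)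
Lemma homog_coef_x0 (K : closedFieldType) n d (f : {mpoly K[n.+1]}) (q : 'rV[K]_n) :
  f \is d.-homog -> ((xpoly f)`_d).@[q 0] = f.@[center K n 0].
Proof.
move=> /dhomogP hf; rewrite xpoly_coef raddf_sum mevalE /= big_seq [RHS]big_seq.
apply: eq_bigr => m mf; have dm : mdeg m = d by exact: hf.
rewrite big_ord_recl mxE eqxx expr1n mul1r mevalZ rmorph_prod /=.
have [md|md] := eqVneq (m ord0) d; last first.
  rewrite mul0r; apply/esym/eqP; rewrite mulf_eq0; apply/orP; right.
  have : (0 < \sum_(i < n) m (lift ord0 i))%N.
    rewrite lt0n; apply: contraNneq md => s0.
    by rewrite -dm mdegE big_ord_recl s0 addn0.
  rewrite lt0n sum_nat_eq0 negb_forall => /existsP[j]; rewrite implyTb => mj.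
  by rewrite prodf_seq_eq0; apply/hasP; exists j; rewrite ?mem_index_enum //= mxE /= expr0n (negPf mj).
have s0 j : m (lift ord0 j) = 0%N.
  apply/eqP; move: dm; rewrite mdegE big_ord_recl md => /eqP.
  by rewrite -[X in _ == X]addn0 eqn_add2l sum_nat_eq0 => /forallP/(_ j); rewrite implyTb.
by congr (_ * _); apply: eq_bigr => j _; rewrite s0 !expr0 meval1.
Qed.

Section GroebnerBases.
Variables (K : closedFieldType) (n : nat) (I : {mpoly K[n.+1]} -> Prop).
Variables (le : rel 'X_{1..n.+1}) (G : seq {mpoly K[n.+1]}).
Implicit Types (a b c : 'X_{1..n.+1}) (f g : {mpoly K[n.+1]}) (q : 'rV[K]_n).
Hypotheses (I_ideal : is_ideal I) (I_homog : homogeneous_ideal I).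
Hypotheses (elim_le : elimination_ordering le) (groebG : groebner_basis le I G).
Hypothesis G_homog : forall g, g \in G -> g \is homog mdeg.

Lemma groebner_divides f a : I f -> a \in msupp f ->
  (forall b, b \in msupp f -> le b a) ->
  exists g b c, [/\ g \in G, b \in msupp g, forall b', b' \in msupp g -> le b' b
                   & a = (b + c)%MM].
Proof.
move=> If af amax; case: groebG => _ /(_ (f@_a *: 'X_[a]))[H _].
have {H}[|s [hs e]] := H; first by apply: ideal_gen_sub; exists f => //; exists a.
have : (\sum_(u <- s) u.1 * u.2)@_a != 0.
  by rewrite -e mcoeffZ mcoeffX eqxx mulr1 -mcoeff_msupp.
rewrite raddf_sum /=; have [[u us ua]|all0] := altP (@hasP _ (fun u => (u.1 * u.2)@_a != 0) s).
  move=> _; have [g gG [b [bg bmax eb]]] := hs _ us.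
  move: ua; rewrite -mcoeff_msupp => /msuppM_le/allpairsP[[m1 m2] /= [_ hm2 ->]].
  move: hm2; rewrite eb => /msuppZ_le; rewrite msuppX inE => /eqP->.
  by exists g, b, m1; split=> //; rewrite addmC.
move: all0; rewrite -all_predC => /allP all0; rewrite big_seq big1 ?eqxx // => u us.
by apply/eqP; rewrite -[_ == _]negbK; apply: all0.
Qed.

(** Division by the basis preserves the leading x_0-coefficient at q as long as every
    divisor used has a leading x_0-coefficient vanishing at q.  Among forms of a fixed
    degree there are finitely many monomials, so this cannot go on forever. *)
Lemma groebner_lc_homog d k f q : I f -> f \is d.-homog ->
  (size (xpoly f) <= k.+1)%N -> ((xpoly f)`_k).@[q 0] != 0 ->
  exists2 g, g \in G & (size (xpoly g) <= k.+1)%N && ((xlc g).@[q 0] != 0).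
Proof.
case: I_ideal (elim_le) => _ ID IM [[anti _ _ addle _] _].
pose below a := [set b : 'X_{1..n.+1 < d.+1} | le b a].
move=> If hf sf fq; have f0 : f != 0.
  by apply: contraNneq fq => ->; rewrite xpoly0 coef0 meval0.
have [a af amax] := leading_monomial elim_le f0.
have [N] := ubnP #|below a|; elim: N => // N IH in f a If hf sf fq f0 af amax *.
rewrite ltnS => card_a.
have [g [b [c [gG bg bmax ea]]]] := groebner_divides If af amax.
have szf := size_xpoly_leading elim_le af amax.
have szg := size_xpoly_leading elim_le bg bmax.
have ak : a ord0 = k.
  apply/eqP; rewrite eqn_leq -ltnS -[X in (X <= _)%N && _]szf sf /= -ltnS -[X in (_ < X)%N]szf.
  rewrite ltnNge; apply: contra fq => /leq_sizeP->//.
  by rewrite meval0.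
have bk : (size (xpoly g) <= k.+1)%N.
  by apply: (@leq_trans (b ord0).+1); [apply: eq_leq|rewrite ltnS -ak ea mnmDE leq_addr].
have [gq|gq] := boolP ((xlc g).@[q 0] == 0); last first.
  by exists g; [exact: gG|apply/andP; split].
pose h := (f@_a / g@_b) *: ('X_[c] * g).
have Ih : I h.
  rewrite /h -mul_mpolyC mulrA; apply: IM; case: groebG => GI _; exact: GI.
have If' : I (f - h) by apply: ID => //; rewrite -mulN1r; apply: IM.
have da : mdeg a = d by exact: (dhomogP _ _ _ hf).
have hh : h \is d.-homog.
  have /homogP[e he] := G_homog gG; have db : mdeg b = e by exact: (dhomogP _ _ _ he).
  rewrite rpredZ // -da ea mdegD addnC; apply: dhomogM; last by rewrite db.
  by rewrite dhomogX.
have hsupp b' : b' \in msupp h -> le b' a.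
  move=> /msuppZ_le; rewrite mulrC => /msuppM_le/allpairsP[[m1 m2] /= [hm1 hm2 ->]].
  by move: hm2; rewrite msuppX inE => /eqP->; rewrite ea; apply/addle/bmax.
have fsupp b' : b' \in msupp (f - h) -> le b' a.
  by move=> /msuppB_le; rewrite mem_cat => /orP[/amax|/hsupp].
have sf' : (size (xpoly (f - h)) <= k.+1)%N.
  by apply/size_xpoly_leP => b' /fsupp/(elimination_x0deg elim_le); rewrite ak ltnS.
have fq' : ((xpoly (f - h))`_k).@[q 0] != 0.
  rewrite xpolyB coefB mevalB /h xpolyZ xpolyM xpolyXm -mulrA coefCM coefXnM.
  have -> : (k < c ord0)%N = false by rewrite ltnNge -ak ea mnmDE leq_addl.
  rewrite coefCM !mevalM; have -> : (k - c ord0)%N = (size (xpoly g)).-1.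
    by rewrite -ak ea mnmDE addnK szg.
  by rewrite -lead_coefE -/(xlc g) (eqP gq) !mulr0 subr0.
have f0' : f - h != 0.
  by apply: contraNneq fq' => ->; rewrite xpoly0 coef0 meval0.
have [a' af' amax'] := leading_monomial elim_le f0'.
apply: (IH (f - h) a') => //; first by rewrite rpredB.
apply: leq_trans card_a; apply: proper_card; apply/properP; split.
  apply/subsetP => b'; rewrite !inE => lb; case: elim_le => [[_ tr _ _ _] _].
  exact: tr lb (fsupp _ af').
have da' : (mdeg a < d.+1)%N by rewrite da.
exists (BMultinom da'); rewrite inE /=; first exact: amax.
apply/negP => aa'; have e : a = a' by apply: anti; rewrite aa' fsupp.
have Xga : ('X_[c] * g)@_a = g@_b by rewrite mulrC ea addmC mcoeffMX.
by move: af'; rewrite -e mcoeff_msupp mcoeffB mcoeffZ Xga divfK ?subrr ?eqxx // -mcoeff_msupp.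
Qed.

Lemma pihomog_sum (f : {mpoly K[n.+1]}) : f = \sum_(d < msize f) pihomog mdeg d f.
Proof. exact: (@pihomog_partitionE _ _ mdeg). Qed.

(** Some homogeneous component of f contributes to its leading x_0-coefficient at q. *)
Lemma groebner_lc f q : I f -> (xlc f).@[q 0] != 0 ->
  exists2 g, g \in G & (size (xpoly g) <= size (xpoly f))%N && ((xlc g).@[q 0] != 0).
Proof.
move=> If; rewrite /xlc lead_coefE; set k := _.-1 => fk.
have kf : size (xpoly f) = k.+1.
  rewrite prednK // size_poly_gt0; apply: contraNneq fk => ->.
  by rewrite coef0 meval0.
have [d fd] : exists d : 'I_(msize f), ((xpoly (pihomog mdeg d f))`_k).@[q 0] != 0.
  apply/existsP; apply: contraNT fk; rewrite negb_exists => /forallP h.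
  rewrite {1}(pihomog_sum f) xpoly_sum coef_sum raddf_sum big1 //= => d _.
  by apply/eqP; rewrite -[_ == _]negbK.
rewrite kf; apply: (@groebner_lc_homog d k (pihomog mdeg d f)) => //.
- exact: I_homog.
- exact: pihomogP.
apply/size_xpoly_leP => m; rewrite pihomogE => /msupp_sum_le/flattenP[s].
case/mapP => a; rewrite mem_filter => /andP[_ af] -> /msuppZ_le.
rewrite msuppX inE => /eqP->; move: a af; apply/size_xpoly_leP; exact: eq_leq.
Qed.

Hypothesis center_outside : ~ vanish I (center K n).

(** In a form of degree d that does not vanish at p, the coefficient of x_0^d is a nonzero
    constant, which survives at every q. *)
Lemma groebner_nonvanishing q : has (fun g => (xlc g).@[q 0] != 0) G.
Proof.
apply: contraT => noG; case: center_outside; split.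
  by apply/eqP => /rowP/(_ ord0)/eqP; rewrite !mxE !eqxx oner_eq0.
move=> f If; apply/eqP; apply: contraT => fc.
have [d fd] : exists d : 'I_(msize f), (pihomog mdeg d f).@[center K n 0] != 0.
  apply/existsP; apply: contraNT fc; rewrite negb_exists => /forallP h.
  rewrite {1}(pihomog_sum f) raddf_sum big1 //= => d _.
  by apply/eqP; rewrite -[_ == _]negbK.
have hd : pihomog mdeg d f \is d.-homog by exact: pihomogP.
have [|||g gG /andP[_ gq]] := @groebner_lc_homog d d (pihomog mdeg d f) q _ hd.
- exact: I_homog.
- apply/size_xpoly_leP => m md; rewrite ltnS.
  have <- : mdeg m = d by exact: (dhomogP _ _ _ hd).
  by rewrite mdegE big_ord_recl leq_addr.
- by rewrite homog_coef_x0.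
by case/negP: noG; apply/hasP; exists g.
Qed.

(** By [groebner_lc], a basis element of least x_0-degree among those surviving at q also
    has least x_0-degree among all surviving elements of the ideal, as [map_poly_dvd]
    requires. *)
Theorem fiber_generator q : exists g,
  [/\ g \in G, (xlc g).@[q 0] != 0,
      forall h, h \in G -> (xlc h).@[q 0] != 0 ->
        (size (xpoly g) <= size (xpoly h))%N
    & forall f, I f -> spec q g %| spec q f].
Proof.
pose P m := has (fun g => ((xlc g).@[q 0] != 0) && (size (xpoly g) == m)) G.
have exP : exists m, P m.
  have /hasP[g gG gq] := groebner_nonvanishing q.
  by exists (size (xpoly g)); apply/hasP; exists g; rewrite ?gq ?eqxx.
have [m /hasP[g gG /andP[gq /eqP gm]] m_min] := ex_minnP exP.
have g_min h : h \in G -> (xlc h).@[q 0] != 0 -> (size (xpoly g) <= size (xpoly h))%N.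
  move=> hG hq; rewrite gm; apply: m_min; apply/hasP; exists h => //.
  by rewrite hq eqxx.
exists g; split=> // f If; case: I_ideal => I0 ID IM.
pose J p := exists2 f, I f & p = xpoly f.
apply: (@map_poly_dvd _ _ (meval (q 0)) J) => //.
- move=> _ _ [f1 If1 ->] [f2 If2 ->]; exists (f1 - f2); rewrite ?xpolyB //.
  by apply: ID => //; rewrite -mulN1r; apply: IM.
- move=> p _ [f1 If1 ->]; exists ((\sum_(i < size p) embS p`_i * 'X_ord0 ^+ i) * f1).
    exact: IM.
  rewrite xpolyM; congr (_ * _); rewrite xpoly_sum -[LHS]coefK poly_def.
  by apply: eq_bigr => i _; rewrite xpolyM xpoly_embS xpolyXn xpolyX0 mul_polyC.
- by exists g => //; case: groebG => GI _; apply: GI.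
- move=> _ [f1 If1 ->] sf1; apply/eqP; apply: contraT => fq.
  have [h hG /andP[hf hq]] := groebner_lc If1 fq.
  by move: sf1; rewrite ltnNge (leq_trans (g_min _ hG hq)).
by exists f.
Qed.

End GroebnerBases.

(** * The scheme-theoretic fiber as a principal ideal *)

Section GradedMaps.
Variables (K : closedFieldType) (m n s : nat) (T : {mpoly K[m]} -> {mpoly K[n]}).
Hypothesis T_sum : forall N (F : 'I_N -> {mpoly K[m]}),
  T (\sum_(i < N) F i) = \sum_(i < N) T (F i).
Hypothesis T_homog : forall d f, f \is d.-homog -> T f \is (d + s).-homog.

Lemma pihomog_graded d f : pihomog mdeg (d + s) (T f) = T (pihomog mdeg d f).
Proof.
have sN : (msize f <= maxn (msize f) d.+1)%N by rewrite leq_maxl.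
have dN : (d < maxn (msize f) d.+1)%N by rewrite leq_maxr.
rewrite {1}(@pihomog_partitionE _ _ mdeg _ _ sN) T_sum raddf_sum (bigD1 (Ordinal dN)) //=.
rewrite [X in X + _]pihomog_dE; last by apply: T_homog; apply: pihomogP.
rewrite big1 ?addr0 // => i; rewrite -val_eqE /= => ne.
apply: pihomog_ne0 (T_homog (pihomogP _ _ _)); by rewrite eqn_add2r.
Qed.

End GradedMaps.

(** If an ideal contains a form e with nonzero x_0^D-term, then x_0^D is a multiple of y
    modulo the ideal; hence powers of y alone detect membership in the saturation. *)
Lemma saturation_y (K : closedFieldType) (J : {mpoly K[2]} -> Prop) (D M : nat)
    (e f : {mpoly K[2]}) :
  (forall f g, J f -> J g -> J (f + g)) -> (forall f g, J g -> J (f * g)) ->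
  J e -> e \is D.-homog -> (dehom e)`_D != 0 ->
  J ('X_ord_max ^+ M * f) -> saturation J f.
Proof.
move=> JD JM Je he eD Jf; set y : {mpoly K[2]} := 'X_ord_max.
set al := (dehom e)`_D in eD; pose x : {mpoly K[2]} := 'X_ord0.
pose W : {mpoly K[2]} := \sum_(i < D) (dehom e)`_i *: (x ^+ i * y ^+ (D - i).-1).
have eE : e = al *: x ^+ D + y * W.
  rewrite -{1}(homogenizeK he) /homogenize big_ord_recr /= subnn expr0 mulr1 addrC.
  congr (_ + _); rewrite /W mulr_sumr; apply: eq_bigr => i _.
  rewrite -scalerAr mulrCA -exprS prednK // subn_gt0; exact: ltn_ord.
have JxM : J (x ^+ (D * M) * f).
  have -> : x ^+ (D * M) * f = (al ^- M)%:MP * ((al *: x ^+ D) ^+ M * f).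
    rewrite exprZn mulrA mul_mpolyC scalerA mulVf ?scale1r ?expf_neq0 //.
    by rewrite exprM.
  apply: (JM); rewrite -[(al *: _) ^+ M](subrK ((- (y * W)) ^+ M)) subrXX opprK -eE mulrDl.
  apply: JD; first by rewrite -mulrA mulrC; apply: JM.
  by rewrite -mulrN exprMn mulrAC mulrC; apply: JM.
(* A monomial of this degree is divisible by x_0^(D M) or by y^M. *)
exists (D * M + M)%N => a; rewrite mdeg2 => aN; rewrite mpolyX2.
have [Ma|aM] := leqP M (a ord_max).
  rewrite -(subnK Ma) exprD mulrA -[_ * f]mulrA; exact: JM.
have Da : (D * M <= a ord0)%N.
  by rewrite -(leq_add2r M) -aN leq_add2l ltnW.
rewrite -(subnK Da) exprD -!mulrA [X in J (_ * X)]mulrCA.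
rewrite [X in J (_ * (X))]mulrCA; apply: (JM); rewrite mulrCA; exact: JM.
Qed.

Section Fiber.
Variables (K : closedFieldType) (n : nat) (I : {mpoly K[n.+1]} -> Prop) (q : 'rV[K]_n).
Hypotheses (I_ideal : is_ideal I) (I_homog : homogeneous_ideal I) (q_neq0 : q != 0).
Implicit Types (f h : {mpoly K[2]}) (g : {mpoly K[n.+1]}).

Lemma line_class_surj f : exists g, line_class q g = f.
Proof.
have [j qj] : exists j, q 0 j != 0.
  apply/existsP; apply: contraNT q_neq0; rewrite negb_exists => /forallP h.
  by apply/eqP/rowP => j; rewrite mxE; apply/eqP; rewrite -[_ == _]negbK.
exists (\sum_(m <- msupp f) f@_m *: ('X_ord0 ^+ m ord0 *
  ((q 0 j)^-1 *: 'X_(lift ord0 j)) ^+ m ord_max)).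
rewrite line_class_sum [RHS]mpolyE; apply: eq_bigr => m _.
rewrite line_classZ line_classM !line_classXn line_classX0 line_classZ line_classXS.
by rewrite scalerA mulVf // scale1r (mpolyX2 _ m).
Qed.

Lemma fiber_idealD f h : fiber_ideal I q f -> fiber_ideal I q h -> fiber_ideal I q (f + h).
Proof.
case: I_ideal => _ ID _ [g1 I1 ->] [g2 I2 ->]; exists (g1 + g2); first exact: ID.
by rewrite line_classD.
Qed.

Lemma fiber_idealM f h : fiber_ideal I q h -> fiber_ideal I q (f * h).
Proof.
case: I_ideal => _ _ IM [g1 I1 ->]; have [g2 <-] := line_class_surj f.
by exists (g2 * g1); [exact: IM | rewrite line_classM].
Qed.

Variables (g0 : {mpoly K[n.+1]}) (l : nat).
Hypotheses (Ig0 : I g0) (g0_homog : g0 \is homog mdeg).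
Hypothesis size_g0 : size (spec q g0) = l.+1.
Hypothesis g0_gen : forall g, I g -> spec q g0 %| spec q g.

Lemma dehomK_g0 : dehom (homogenize l (spec q g0)) = spec q g0.
Proof. by rewrite dehomK ?size_g0. Qed.

Lemma line_class_g0 :
  line_class q g0 = 'X_ord_max ^+ ((msize g0).-1 - l) * homogenize l (spec q g0).
Proof.
set t := (msize g0).-1; have ht : g0 \is t.-homog by rewrite -homog_msize.
have lct : line_class q g0 \is t.-homog by exact: line_class_homog.
have lt : (l <= t)%N.
  by have := size_dehom lct; rewrite dehom_line_class size_g0.
apply: (dehom_inj lct).
  rewrite -{2}(subnK lt); apply: dhomogM; last exact: homogenize_homog.
  by rewrite -[X in X.-homog]mul1n; apply: dhomogMn; rewrite dhomogX /= mdeg1.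
by rewrite dehom_line_class dehomM dehomXn dehomX1 expr1n mul1r dehomK_g0.
Qed.

Hypothesis center_outside : exists2 e, I e & e.@[center K n 0] != 0.

(** Up to a power of y, which saturation removes, the homogenization of [spec q g0] is the
    restriction of g0 to the line and so lies in the ideal of the fiber.  Conversely, each
    homogeneous component of an element of the saturation becomes, at y = 1, the
    specialization of an element of I, and divisibility is tested there. *)
Theorem fiber_saturation f :
  saturation (fiber_ideal I q) f <-> exists h, f = h * homogenize l (spec q g0).
Proof.
have hB := homogenize_homog l (spec q g0).
split.
  case=> M satM; have [g Ig eg] : fiber_ideal I q ('X_ord_max ^+ M * f).
    have := satM (U_(ord_max) *+ M)%MM; rewrite -mpolyXn; apply.
    by rewrite mdegMn mdeg1 mul1n.
  have dvd d : dehom (homogenize l (spec q g0)) %| dehom (pihomog mdeg d f).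
    have lcg : line_class q (pihomog mdeg (d + M) g) = pihomog mdeg (d + M) (line_class q g).
      apply/esym; rewrite -{1}[(d + M)%N]addn0.
      apply: (pihomog_graded (T := line_class q)) => [N F|d' f' hf'].
        exact: line_class_sum.
      by rewrite addn0; apply: line_class_homog.
    have yf : pihomog mdeg (d + M) ('X_ord_max ^+ M * f) = 'X_ord_max ^+ M * pihomog mdeg d f.
      apply: (pihomog_graded (T := fun f => 'X_ord_max ^+ M * f)) => [N F|d' f' hf'].
        by rewrite mulr_sumr.
      rewrite addnC; apply: dhomogM => //.
      by rewrite -[X in X.-homog]mul1n; apply: dhomogMn; rewrite dhomogX /= mdeg1.
    have -> : dehom (pihomog mdeg d f) = spec q (pihomog mdeg (d + M) g).
      by rewrite -dehom_line_class lcg -eg yf dehomM dehomXn dehomX1 expr1n mul1r.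
    by rewrite dehomK_g0; apply/g0_gen/I_homog.
  have sB : size (dehom (homogenize l (spec q g0))) = l.+1 by rewrite dehomK_g0.
  exists (\sum_(d < msize f)
    homogenize (d - l) (dehom (pihomog mdeg d f) %/ dehom (homogenize l (spec q g0)))).
  rewrite mulr_suml {1}(@pihomog_partitionE _ _ mdeg _ f (leqnn _)).
  by apply: eq_bigr => d _; apply: homogenize_divp (pihomogP _ _ _) hB sB (dvd d).
case=> h ->; case: center_outside => e Ie ec.
have [d ed] : exists d : 'I_(msize e), (pihomog mdeg d e).@[center K n 0] != 0.
  apply/existsP; apply: contraNT ec; rewrite negb_exists => /forallP H.
  rewrite {1}(pihomog_sum e) raddf_sum big1 //= => d _.
  by apply/eqP; rewrite -[_ == _]negbK.
have hd : pihomog mdeg d e \is d.-homog by exact: pihomogP.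
apply: (@saturation_y _ _ d ((msize g0).-1 - l) (line_class q (pihomog mdeg d e))).
- exact: fiber_idealD.
- exact: fiber_idealM.
- by exists (pihomog mdeg d e) => //; apply: I_homog.
- exact: line_class_homog.
- by rewrite dehom_line_class coef_spec (homog_coef_x0 q hd).
by rewrite mulrCA -line_class_g0; apply: fiber_idealM; exists g0.
Qed.

End Fiber.

(** * Root multiplicities *)

Section RootTypes.
Variable K : closedFieldType.
Implicit Types (p : {poly K}) (c r : K) (lam : seq nat) (F : {mpoly K[2]}).

Definition root_type lam p := exists2 r : 'I_(size lam) -> K, injective r &
  p %= \prod_(i < size lam) ('X - (r i)%:P) ^+ nth 0%N lam i.

Lemma sumn_ord lam : sumn lam = \sum_(i < size lam) nth 0%N lam i.
Proof. by rewrite sumnE (big_nth 0%N) big_mkord. Qed.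

Lemma size_root_type lam p : root_type lam p -> size p = (sumn lam).+1.
Proof.
case=> r _ /eqp_size->; rewrite size_prod => [|i _]; last first.
  by rewrite -size_poly_eq0 size_exp_XsubC.
under eq_bigr => i _ do rewrite size_exp_XsubC -addn1.
by rewrite big_split /= sum_nat_const muln1 -sumn_ord -addSn addnK.
Qed.

Lemma root_type_eqp lam p p' : p %= p' -> root_type lam p -> root_type lam p'.
Proof. by move=> pp' [r r_inj pr]; exists r; rewrite // -(eqp_ltrans pp'). Qed.

Lemma coef_comp_scaleX p c j : (p \Po (c *: 'X))`_j = p`_j * c ^+ j.
Proof.
rewrite comp_polyE coef_sum.
under eq_bigr => i _ do rewrite coefZ exprZn coefZ coefXn.
case: (ltnP j (size p)) => [jp|pj]; last first.
  rewrite [p`_j]nth_default // mul0r big1 // => i _.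
  by rewrite gtn_eqF ?mulr0 // (leq_trans _ pj).
rewrite (bigD1 (Ordinal jp)) //= eqxx mulr1 big1 ?addr0 // => i.
by rewrite -val_eqE /= eq_sym => /negPf->; rewrite !mulr0.
Qed.

Lemma root_type_scale lam p c :
  c != 0 -> root_type lam p -> root_type lam (p \Po (c *: 'X)).
Proof.
move=> c0 [r r_inj /eqpf_eq[a a0 ->]]; exists (fun i => c^-1 * r i).
  by move=> i j /mulfI e; apply: r_inj; apply: e; rewrite invr_eq0.
rewrite comp_polyZ rmorph_prod /=.
have XsubE i : ('X - (r i)%:P) \Po (c *: 'X) = c *: ('X - (c^-1 * r i)%:P).
  by rewrite comp_polyB comp_polyX comp_polyC scalerBr -[_ *: _%:P]mul_polyC -polyCM mulVKf.
under eq_bigr => i _ do rewrite rmorphXn /= XsubE exprZn.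
rewrite scaler_prod scalerA; apply: eqp_scale.
by rewrite mulf_neq0 // prodf_seq_neq0; apply/allP => i _; rewrite /= expf_neq0.
Qed.

Lemma root_type_scaleE lam p c :
  c != 0 -> root_type lam p <-> root_type lam (p \Po (c *: 'X)).
Proof.
move=> c0; split; first exact: root_type_scale.
have {2}-> : p = (p \Po (c *: 'X)) \Po (c^-1 *: 'X).
  apply/polyP => j; rewrite !coef_comp_scaleX -mulrA -exprMn mulfV //.
  by rewrite expr1n mulr1.
by apply: root_type_scale; rewrite invr_eq0.
Qed.

Lemma root_type_exists p : p != 0 ->
  exists2 lam, is_partition lam (size p).-1 & root_type lam p.
Proof.
move=> p0; have [s pE] := closed_field_poly_normal p.
pose lam := [seq count_mem x s | x <- undup s].
have rt : root_type lam p.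
  exists (fun i => nth 0 (undup s) i) => [i j e|].
    apply/val_inj/eqP; move: (ltn_ord i) (ltn_ord j); rewrite {2 4}size_map => si sj.
    by rewrite -(nth_uniq 0 si sj (undup_uniq s)) e.
  rewrite {1}pE; apply: (eqp_trans (eqp_scale _ _)); first by rewrite lead_coef_eq0.
  rewrite -(big_undup_iterop_count _ s xpredT) (big_nth 0) big_mkord size_map.
  rewrite (eq_bigr (fun i : 'I_(size (undup s)) =>
    ('X - (nth 0 (undup s) i)%:P) ^+ nth 0%N lam i)) ?eqpxx // => i _.
  by rewrite (nth_map 0).
exists lam => //; split; last by rewrite (size_root_type rt).
by apply/allP => _ /mapP[x xs ->]; rewrite -has_count has_pred1 -mem_undup.
Qed.

(** Evaluation at (1 : 0), the point of P^1 missed by y = 1. *)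
Definition at_infinity F : K := F.@[fun i : 'I_2 => if i == ord0 then 1 else 0].

Lemma at_infinityX F i : at_infinity (F ^+ i) = at_infinity F ^+ i.
Proof. exact: rmorphXn. Qed.

Lemma at_infinityM F F' : at_infinity (F * F') = at_infinity F * at_infinity F'.
Proof. exact: rmorphM. Qed.

Lemma at_infinity_prod (T : Type) (s : seq T) (P : pred T) (L : T -> {mpoly K[2]}) :
  at_infinity (\prod_(i <- s | P i) L i) = \prod_(i <- s | P i) at_infinity (L i).
Proof. exact: rmorph_prod. Qed.

Lemma at_infinityE d F : F \is d.-homog -> at_infinity F = (dehom F)`_d.
Proof.
move=> hF; rewrite -{1}(homogenizeK hF) /at_infinity /homogenize raddf_sum /=.
rewrite big_ord_recr big1 /= ?add0r => [|i _].
  by rewrite mevalZ mevalM rmorphXn /= mevalXU expr1n mul1r subnn expr0 meval1 mulr1.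
rewrite mevalZ mevalM rmorphXn /= mevalXU expr1n mul1r rmorphXn /= mevalXU /=.
by rewrite expr0n subn_eq0 leqNgt ltn_ord mulr0.
Qed.

Lemma dhomog_prod_ord m (d : 'I_m -> nat) (L : 'I_m -> {mpoly K[2]}) :
  (forall i, L i \is (d i).-homog) ->
  \prod_(i < m) L i \is (\sum_(i < m) d i).-homog.
Proof.
by move=> hL; elim/big_rec2: _ => [|i s p _ hp]; [exact: dhomog1 | exact: dhomogM].
Qed.

Definition power_prod lam (L : 'I_(size lam) -> {mpoly K[2]}) : {mpoly K[2]} :=
  \prod_(i < size lam) L i ^+ nth 0%N lam i.

Lemma power_prod_homog lam (L : 'I_(size lam) -> {mpoly K[2]}) :
  (forall i, L i \is 1.-homog) -> power_prod L \is (sumn lam).-homog.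
Proof.
move=> hL; rewrite sumn_ord; apply: dhomog_prod_ord => i.
by rewrite -[X in X.-homog]mul1n; apply: dhomogMn.
Qed.

Lemma dehom_power_prod lam (L : 'I_(size lam) -> {mpoly K[2]}) :
  dehom (power_prod L) = \prod_(i < size lam) dehom (L i) ^+ nth 0%N lam i.
Proof.
rewrite /power_prod [LHS]rmorph_prod; apply: eq_bigr => i _; exact: dehomXn.
Qed.

(** The forms must have no root at (1 : 0), so that none of their roots is lost when
    y is set to 1. *)
Lemma power_prod_root_type lam (L : 'I_(size lam) -> {mpoly K[2]}) :
  all (leq 1) lam -> (forall i, L i \is 1.-homog) ->
  (forall i j, i != j -> ~ exists b : K, L i = b *: L j) ->
  at_infinity (power_prod L) != 0 -> root_type lam (dehom (power_prod L)).
Proof.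
move=> /allP lam1 hL indep; rewrite at_infinity_prod => nz.
pose al i := (dehom (L i))`_1; pose r i := - ((dehom (L i))`_0 / al i).
have al0 i : al i != 0.
  rewrite /al -at_infinityE //; apply: contraNneq nz => Li.
  rewrite (bigD1 i) //= at_infinityX Li expr0n.
  have /lam1 : nth 0%N lam i \in lam by rewrite mem_nth.
  by rewrite lt0n => /negPf->; rewrite mul0r.
have LE i : dehom (L i) = al i *: ('X - (r i)%:P).
  rewrite scalerBr -[_ *: _%:P]mul_polyC -polyCM /r mulrN polyCN opprK mulrC divfK //.
  rewrite -[LHS]coefK; apply/polyP => -[|[|j]].
  - rewrite coef_poly coefD coefZ coefX coefC mulr0 add0r.
    by case: ltnP => // ?; rewrite nth_default.
  - rewrite coef_poly coefD coefZ coefX coefC mulr1 addr0 /al.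
    by case: ltnP => // ?; rewrite nth_default.
  rewrite coef_poly coefD coefZ coefX coefC mulr0 addr0.
  by case: ltnP => // js; rewrite nth_default // (leq_trans (size_dehom (hL i))).
exists r => [i j rij|].
  have [//|/indep[]] := eqVneq i j; exists (al i / al j).
  apply: (dehom_inj (hL i)); first exact: (rpredZ _ (hL j)).
  by rewrite dehomZ !LE rij scalerA divfK.
rewrite dehom_power_prod; under eq_bigr => i _ do rewrite LE exprZn.
rewrite scaler_prod eqp_scale // prodf_seq_neq0; apply/allP => i _ /=.
by rewrite expf_neq0.
Qed.

Definition root_row r : 'rV[K]_2 := \row_i (if i == ord0 then r else 1).

Lemma point_form_homog (v : 'rV[K]_2) : point_form v \is 1.-homog.
Proof. by rewrite rpredB // rpredZ // dhomogX /= mdeg1. Qed.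

Lemma dehom_point_form (v : 'rV[K]_2) :
  dehom (point_form v) = v 0 ord_max *: 'X - (v 0 ord0)%:P.
Proof. by rewrite dehomB !dehomZ dehomX0 dehomX1 alg_polyC. Qed.

Lemma dehom_root_form r : dehom (point_form (root_row r)) = 'X - r%:P.
Proof. by rewrite dehom_point_form !mxE scale1r. Qed.

Lemma point_form_proportional (v w : 'rV[K]_2) : v != 0 ->
  (exists b : K, point_form v = b *: point_form w) -> same_point v w.
Proof.
move=> v0 [b e]; have e0 := congr1 (mcoeff U_(ord0)%MM) e.
have e1 := congr1 (mcoeff U_(ord_max)%MM) e; move: e0 e1.
rewrite !(mcoeffZ, mcoeffB, mcoeffXU) !mulr1 !mulr0 !subr0 !sub0r mulrN => e0 /oppr_inj e1.
have ve : v = b *: w.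
  apply/rowP => j; rewrite mxE; have [->//|j0] := eqVneq j ord0.
  by have -> : j = ord_max by apply/val_inj; case: j j0 => [[|[]]].
by exists b => //; apply: contraNneq v0 => b0; rewrite ve b0 scale0r.
Qed.

Lemma same_point_root_row r s : same_point (root_row r) (root_row s) -> r = s.
Proof.
case=> c _ /rowP e; move: (e ord0) (e ord_max); rewrite !mxE /= mulr1 => -> <-.
by rewrite mul1r.
Qed.

End RootTypes.

(** * Fibers and coincident root loci *)

Section RootTypesOfForms.
Variable K : closedFieldType.
Implicit Types (lam : seq nat).

Lemma root_forms lam (r : 'I_(size lam) -> K) : injective r ->
  [/\ forall i, point_form (root_row (r i)) \is 1.-homog,
      forall i j, i != j -> ~ same_point (root_row (r i)) (root_row (r j)),
      forall i j, i != j ->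
        ~ exists b : K, point_form (root_row (r i)) = b *: point_form (root_row (r j)) &
      dehom (power_prod (fun i => point_form (root_row (r i)))) =
        \prod_(i < size lam) ('X - (r i)%:P) ^+ nth 0%N lam i].
Proof.
move=> r_inj; have distinct i j : i != j -> ~ same_point (root_row (r i)) (root_row (r j)).
  by move=> /eqP ij /same_point_root_row/r_inj.
split=> // [i|i j /distinct ij /point_form_proportional sp|].
- exact: point_form_homog.
- by apply/ij/sp/eqP => /rowP/(_ ord_max)/eqP; rewrite !mxE /= oner_eq0.
by rewrite dehom_power_prod; apply: eq_bigr => i _; rewrite dehom_root_form.
Qed.

(** The hypothesis on a says that the form does not vanish at (1 : 0), so that all its
    roots are visible at y = 1. *)
Lemma XpartE k lam (a : 'rV[K]_k.+1) : is_partition lam k -> a 0 ord0 != 0 ->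
  Xpart lam a <-> root_type lam (dehom (binary_form a)).
Proof.
move=> [lam1 lamk] a0; have ha : binary_form a \is k.-homog.
  rewrite rpred_sum // => i _; rewrite rpredZ // dhomogX /= mdeg2 !mnmE /=.
  by rewrite -[(_ + _)%N]/(k - i + i)%N subnK // -ltnS.
have a_inf : at_infinity (binary_form a) = a 0 ord0.
  rewrite /at_infinity /binary_form raddf_sum big_ord_recl big1 /= => [|i _].
    rewrite mevalZ mpolyX2 !mnmE /= expr0 mulr1 rmorphXn /= mevalXU expr1n mulr1.
    exact: addr0.
  rewrite mevalZ mpolyX2 !mnmE mevalM [X in _ * (_ * X)]rmorphXn /= mevalXU /=.
  by rewrite expr0n !mulr0.
split=> [[_ [L [c [hL indep c0 aE]]]]|[r r_inj /eqpf_eq[c c0 ar]]].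
  have aE' : binary_form a = c *: power_prod L := aE.
  apply: (@root_type_eqp _ _ (dehom (power_prod L))).
    by rewrite aE' dehomZ eqp_sym eqp_scale.
  apply: power_prod_root_type => //; apply: contraNneq a0 => L0.
  by rewrite -a_inf aE' /at_infinity mevalZ -/(at_infinity _) L0 mulr0.
have [hL _ indep dE] := root_forms r_inj.
split; first by apply: contraNneq a0 => ->; rewrite mxE.
exists (fun i => point_form (root_row (r i))), c; split=> //.
apply: (dehom_inj ha); first by rewrite rpredZ // -lamk; apply: power_prod_homog.
by rewrite ar -dE dehomZ.
Qed.

Lemma dehom_restriction n k (y : {mpoly K[n]}) (q : 'rV[K]_n) (g : {mpoly K[n.+1]}) :
  y.@[q 0] != 0 -> g \is homog mdeg -> size (xpoly g) = k.+1 ->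
  exists2 c : K, c != 0 &
    dehom (binary_form (restriction k y q g)) = c *: (spec q g \Po (y.@[q 0] *: 'X)).
Proof.
set u := y.@[q 0] => u0 hg sg; pose t := (msize g).-1.
exists (u ^- (t - k) * u ^- k); first by rewrite mulf_neq0 // invr_eq0 expf_neq0.
apply/polyP => j; rewrite dehom_sum coef_sum coefZ coef_comp_scaleX coef_spec.
under eq_bigr => i _ do rewrite dehomZ dehomXm mnmE eqxx coefZ coefXn.
have [jk|kj] := ltnP j k.+1; last first.
  rewrite [(xpoly g)`_j]nth_default ?sg // meval0 mul0r mulr0 big1 // => i _.
  rewrite gtn_eqF ?mulr0 //; apply: leq_trans kj; by rewrite ltnS leq_subr.
have kj : (k - j < k.+1)%N by rewrite ltnS leq_subr.
rewrite (bigD1 (Ordinal kj)) //= big1 ?addr0 => [|i]; last first.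
  rewrite -val_eqE /= => ne; case: eqP => [e|]; rewrite ?mulr0 //.
  by case/eqP: ne; rewrite e subKn // -ltnS.
rewrite subKn // eqxx mulr1.
rewrite restrictionE //= -?xpolyE // subKn // -/u -/t.
have -> : u ^+ (t - k + (k - j)) = u ^+ (t - k) * (u ^+ k / u ^+ j).
  have jk' : (j <= k)%N by [].
  rewrite exprD; congr (_ * _); apply: (mulIf (expf_neq0 j u0)).
  by rewrite divfK ?expf_neq0 // -exprD subnK.
rewrite !invfM invrK [LHS]mulrC -!mulrA; congr (_ * _); congr (_ * _).
by rewrite mulrC.
Qed.

End RootTypesOfForms.

Section FiberDivisor.
Variables (K : closedFieldType) (n : nat) (I : {mpoly K[n.+1]} -> Prop) (q : 'rV[K]_n).
Hypotheses (I_ideal : is_ideal I) (I_homog : homogeneous_ideal I) (q_neq0 : q != 0).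
Variables (g0 : {mpoly K[n.+1]}).
Hypotheses (Ig0 : I g0) (g0_homog : g0 \is homog mdeg) (spec_g0 : spec q g0 != 0).
Hypothesis g0_gen : forall g, I g -> spec q g0 %| spec q g.
Hypothesis center_outside : exists2 e, I e & e.@[center K n 0] != 0.

(** A divisor is the fiber exactly when its equation generates the same principal
    ideal as the homogenization of [spec q g0]; as that form does not vanish at
    (1 : 0), comparing the two can be done at y = 1. *)
Theorem fiber_divisor_root_type lam : all (leq 1) lam ->
  (exists pts, @fiber_eq_divisor K n I q lam pts) <-> root_type lam (spec q g0).
Proof.
move=> lam1; pose l := (size (spec q g0)).-1.
have sl : size (spec q g0) = l.+1 by rewrite prednK // size_poly_gt0.
have sat := fiber_saturation I_ideal I_homog q_neq0 Ig0 g0_homog sl g0_gen center_outside.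
have hB := homogenize_homog l (spec q g0).
have dB : dehom (homogenize l (spec q g0)) = spec q g0 by rewrite dehomK ?sl.
split=> [[pts [pts0 distinct gen]]|rt].
  have [h1 FE] : exists h, power_prod (fun i => point_form (pts i)) =
      h * homogenize l (spec q g0).
    by apply/sat/gen; exists 1; rewrite mul1r.
  have [h2 BE] : exists h, homogenize l (spec q g0) =
      h * power_prod (fun i => point_form (pts i)).
    by apply/gen/sat; exists 1; rewrite mul1r.
  apply: (@root_type_eqp _ _ (dehom (power_prod (fun i => point_form (pts i))))).
    rewrite /eqp -{1}dB BE FE !dehomM dB dvdp_mull ?dvdpp //= dvdp_mull //.
  apply: power_prod_root_type => // [i|i j ij prop|].
  - exact: point_form_homog.
  - by apply: (distinct i j ij); apply: point_form_proportional.
  have : at_infinity (homogenize l (spec q g0)) != 0.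
    by rewrite (at_infinityE hB) dB -[l]/(l.+1.-1) -sl -lead_coefE lead_coef_eq0.
  by apply: contraNneq => F0; rewrite BE at_infinityM F0 mulr0.
have [r r_inj /eqpf_eq[c c0 rE]] := rt; have [hL distinct _ dE] := root_forms r_inj.
exists (fun i => root_row (r i)); split=> // [i|f].
  by apply/eqP => /rowP/(_ ord_max)/eqP; rewrite !mxE /= oner_eq0.
have lE : l = sumn lam by rewrite /l (size_root_type rt).
have BE : homogenize l (spec q g0) = c *: power_prod (fun i => point_form (root_row (r i))).
  apply: (dehom_inj hB); first by rewrite rpredZ // lE; apply: power_prod_homog.
  by rewrite dB dehomZ dE.
rewrite sat BE; split=> -[h ->].
  by exists (c *: h); rewrite -scalerAr scalerAl.
by exists (c^-1 *: h); rewrite -scalerAr scalerAl scalerA mulfV // scale1r.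
Qed.

End FiberDivisor.

(** * Affineness of hypersurface complements *)

Section AffineComplement.
Variables (K : closedFieldType) (m d : nat).
Variables (A : {mpoly K[m]} -> Prop) (F : {mpoly K[m]}) (X : 'rV[K]_m -> Prop).
Implicit Types (a : 'X_{1..m}) (u v : 'rV[K]_m).
Hypotheses (A_homog : forall f, A f -> f \is homog mdeg).
Hypotheses (F_homog : F \is d.-homog) (d_gt0 : (0 < d)%N).
Hypothesis XE : forall v, X v <-> vanish A v /\ F.@[v 0] != 0.

Lemma meval_scale e (f : {mpoly K[m]}) (c : K) v :
  f \is e.-homog -> f.@[(c *: v) 0] = c ^+ e * f.@[v 0].
Proof.
move=> /dhomogP hf; rewrite !mevalE mulr_sumr big_seq [RHS]big_seq.
apply: eq_bigr => a af; have <- : mdeg a = e by exact: hf.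
rewrite mulrCA; congr (_ * _); rewrite mdegE -prodrXr -big_split.
by apply: eq_bigr => j _; rewrite mxE exprMn.
Qed.

Local Notation N := #|{: 'X_{1..m < d.+1}}|.
Implicit Types (z : 'rV[K]_N).

Let mon (i : 'I_N) : 'X_{1..m} := val (enum_val i).

(** The d-th Veronese embedding in the affine chart F = 1 (padded with zero
    coordinates for the monomials of degree < d). *)
Definition veronese v : 'rV[K]_N := \row_i
  (if mdeg (mon i) == d then 'X_[mon i].@[v 0] / F.@[v 0] else 0).

Definition coord a : {mpoly K[N]} :=
  if insub a is Some b then 'X_(enum_rank b) else 0.

Lemma coord_veronese v a : mdeg a = d -> (coord a).@[veronese v 0] = 'X_[a].@[v 0] / F.@[v 0].
Proof.
move=> ad; have ad' : (mdeg a < d.+1)%N by rewrite ad.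
by rewrite /coord insubT mevalXU mxE /mon enum_rankK /= ad eqxx.
Qed.

(** The monomials x_i^(d-1) x_j: for fixed i, their values recover the point up to a
    scalar wherever x_i is nonzero. *)
Let e (i j : 'I_m) : 'X_{1..m} := (U_(i) *+ d.-1 + U_(j))%MM.

Lemma mdeg_e i j : mdeg (e i j) = d.
Proof. by rewrite mdegD mdegMn !mdeg1 mul1n addn1 prednK. Qed.

Lemma coord_e v i j : (coord (e i j)).@[veronese v 0] = v 0 i ^+ d.-1 / F.@[v 0] * v 0 j.
Proof.
rewrite coord_veronese ?mdeg_e // mpolyXD -mpolyXn mevalM rmorphXn /= !mevalXU.
by rewrite mulrAC.
Qed.

(** The Zariski closure of the image of [X]. *)
Definition veronese_closure z := forall P : {mpoly K[N]},
  (forall v, X v -> P.@[veronese v 0] = 0) -> P.@[z 0] = 0.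

(** A relation between coordinates that holds on the image of X extends to the closure:
    the equations below are proved on the image only. *)
Lemma closure_eq (P Q : {mpoly K[N]}) z : veronese_closure z ->
  (forall v, X v -> P.@[veronese v 0] = Q.@[veronese v 0]) -> P.@[z 0] = Q.@[z 0].
Proof.
move=> Yz PQ; apply/eqP; rewrite -subr_eq0 -mevalB; apply/eqP/Yz => v Xv.
by rewrite mevalB PQ // subrr.
Qed.

Definition chart_point (i : 'I_m) z : 'rV[K]_m := \row_j (coord (e i j)).@[z 0].

Definition veronese_inv z : 'rV[K]_m :=
  if [pick i | (coord (e i i)).@[z 0] != 0] is Some i then chart_point i z else 0.

Lemma chart_point_veronese i v :
  chart_point i (veronese v) = (v 0 i ^+ d.-1 / F.@[v 0]) *: v.
Proof. by apply/rowP => j; rewrite !mxE coord_e. Qed.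

Section Relations.
Variable z : 'rV[K]_N.
Hypothesis Yz : veronese_closure z.

Lemma closure_F : \sum_(a <- msupp F) F@_a * (coord a).@[z 0] = 1.
Proof.
transitivity ((\sum_(a <- msupp F) F@_a *: coord a).@[z 0]).
  by rewrite raddf_sum; apply: eq_bigr => a _; rewrite /= mevalZ.
rewrite -[RHS](meval1 (z 0)); apply: closure_eq => // v /XE[_ Fv].
rewrite raddf_sum /= meval1 -[RHS](divff Fv) [in F.@[_] / _]mevalE.
rewrite mulr_suml big_seq [RHS]big_seq; apply: eq_bigr => a aF.
have ad : mdeg a = d by exact: (dhomogP _ _ _ F_homog).
by rewrite mevalZ coord_veronese // mevalX mulrA.
Qed.

Lemma closure_mon i a : mdeg a = d ->
  'X_[a].@[chart_point i z 0] = (coord (e i i)).@[z 0] ^+ d.-1 * (coord a).@[z 0].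
Proof.
move=> ad; have := @closure_eq (\prod_j coord (e i j) ^+ a j)
  (coord (e i i) ^+ d.-1 * coord a) z Yz.
rewrite mevalM !rmorph_prod !rmorphXn /= mevalX => H.
rewrite -H => [|v Xv]; first by apply: eq_bigr => j _; rewrite mxE rmorphXn.
rewrite mevalM rmorph_prod rmorphXn /= (coord_veronese v ad) coord_e.
under eq_bigr => j _ do rewrite rmorphXn /= coord_e exprMn.
rewrite big_split /= prodrXr -mdegE ad mevalX [in RHS]exprMn; set c := _ / _.
have -> : c ^+ d = c ^+ d.-1 * (v 0 i ^+ d.-1 / F.@[v 0]) by rewrite -exprSr prednK.
by rewrite -!mulrA [_^-1 * _]mulrC.
Qed.

Lemma closure_cross i i' j : (coord (e i j)).@[z 0] * (coord (e i' i)).@[z 0] =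
  (coord (e i' j)).@[z 0] * (coord (e i i)).@[z 0].
Proof.
rewrite -!mevalM; apply: closure_eq => // v _; rewrite !mevalM !coord_e.
rewrite mulrACA [RHS]mulrACA; congr (_ * _); exact: mulrC.
Qed.

(** Otherwise every coordinate would vanish, each being integral over the coordinates
    of the pure powers; but some coordinate occurs in the relation F = 1. *)
Lemma closure_chart : exists i, (coord (e i i)).@[z 0] != 0.
Proof.
apply/existsP; apply: contraT; rewrite negb_exists => /forallP all0.
have z0 i : (coord (e i i)).@[z 0] = 0 by apply/eqP; rewrite -[_ == _]negbK.
case/eqP: (oner_neq0 K); rewrite -closure_F big_seq big1 // => a aF.
have ad : mdeg a = d by exact: (dhomogP _ _ _ F_homog).
have [i ai] : exists i, a i != 0%N.
  apply/existsP; apply: contraTT d_gt0; rewrite negb_exists => /forallP a0.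
  rewrite -leqNgt leqn0 -ad mdegE sum_nat_eq0; apply/forallP => i.
  by rewrite implyTb -[_ == _]negbK.
have := @closure_eq (coord a ^+ d) (\prod_j coord (e j j) ^+ a j) z Yz.
rewrite rmorphXn rmorph_prod /= => H; apply/eqP; rewrite mulf_eq0; apply/orP; right.
have /eqP : (coord a).@[z 0] ^+ d = 0.
  rewrite H => [|v Xv]; first by rewrite (bigD1 i) //= rmorphXn /= z0 expr0n (negPf ai) mul0r.
  rewrite rmorphXn rmorph_prod /= coord_veronese // exprMn mevalX -prodrXl exprVn.
  under [RHS]eq_bigr => j _ do
    rewrite rmorphXn /= coord_e mulrAC -exprSr prednK // exprMn exprVn.
  rewrite big_split /= -exprVn -ad; congr (_ * _).
    by apply: eq_bigr => j _; rewrite -!exprM mulnC.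
  by rewrite mdegE -prodrXr; apply: eq_bigr => j _; rewrite exprVn.
by rewrite expf_eq0 d_gt0.
Qed.

Lemma closure_inv : exists2 i, (coord (e i i)).@[z 0] != 0 & veronese_inv z = chart_point i z.
Proof.
rewrite /veronese_inv; case: pickP => [i zi|none]; first by exists i.
by have [i] := closure_chart; rewrite none.
Qed.

Lemma closure_chart_F i : F.@[chart_point i z 0] = (coord (e i i)).@[z 0] ^+ d.-1.
Proof.
rewrite {1}[F]mpolyE raddf_sum /= -[RHS]mulr1 -closure_F mulr_sumr.
rewrite big_seq [RHS]big_seq; apply: eq_bigr => a aF.
have ad : mdeg a = d by exact: (dhomogP _ _ _ F_homog).
by rewrite mevalZ closure_mon // mulrCA.
Qed.

Lemma closure_inv_X : X (veronese_inv z).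
Proof.
have [i zi ->] := closure_inv; apply/XE; split; last by rewrite closure_chart_F expf_neq0.
split; first by apply: contraNneq zi => /rowP/(_ i); rewrite !mxE => ->.
move=> f Af; have /homogP[l hl] := A_homog Af.
have := @closure_eq (f \mPo [tuple coord (e i j) | j < m]) 0 z Yz.
rewrite comp_mpoly_meval meval0 => <- => [|v /XE[[_ Av] _]].
  by apply: meval_eq => j; rewrite tnth_mktuple mxE.
rewrite comp_mpoly_meval meval0 -[RHS](mulr0 ((v 0 i ^+ d.-1 / F.@[v 0]) ^+ l)) -(Av f Af).
rewrite -meval_scale // -chart_point_veronese.
by apply: meval_eq => j; rewrite tnth_mktuple mxE.
Qed.

Lemma veronese_invK : veronese (veronese_inv z) = z.
Proof.
have [i zi ->] := closure_inv; apply/rowP => b; rewrite mxE.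
case: eqP => [bd|bd].
  rewrite closure_mon // closure_chart_F mulrC mulKf ?expf_neq0 //.
  by rewrite /coord valK mevalXU enum_valK.
rewrite -[z 0 b](mevalXU (z 0)); apply/esym/Yz => v _.
by rewrite mevalXU mxE; case: eqP bd.
Qed.

End Relations.

(** On the closure of the image, the point is recovered from any chart i with
    x_i^d <> 0, and the charts agree up to a scalar; so the closure adds no point. *)
Theorem affine_complement : affine_variety X.
Proof.
split.
  exists (vanish A); first by exists A.
  exists (vanish (fun f => f = F)).
    by exists (fun f => f = F); split=> // f ->; apply/homogP; exists d.
  move=> v; rewrite XE; split=> -[Av Fv]; split=> //.
    by case=> _ /(_ F erefl) F0; rewrite F0 eqxx in Fv.
  apply/eqP => F0; apply: Fv; split; first by case: Av.
  by move=> _ ->.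
have XY v : X v -> veronese_closure (veronese v) by move=> Xv P; apply.
exists N, veronese_closure, veronese, veronese_inv; split.
- by exists (fun P => forall v, X v -> P.@[veronese v 0] = 0).
- by split=> // z; apply: closure_inv_X.
- split=> [v Xv|z]; last exact: veronese_invK.
  have [i zi ->] := closure_inv (XY v Xv); rewrite chart_point_veronese.
  exists (v 0 i ^+ d.-1 / F.@[v 0]) => //.
  by apply: contraNneq zi => c0; rewrite coord_e c0 mul0r.
- move=> b v Xv; exists d, (if mdeg (mon b) == d then 'X_[mon b] else 0), F.
  split=> // [||u _ _]; last by rewrite mxE; case: eqP; rewrite ?meval0 ?mul0r.
    by case: eqP => bd; rewrite ?dhomog0 // dhomogX /= bd.
  by case/XE: Xv.
move=> z Yz; have [i zi _] := closure_inv Yz.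
exists (fun j => coord (e i j)), (coord (e i i)); split=> // w Yw wi.
have [i' wi' ->] := closure_inv Yw.
have wc : chart_point i' w =
    ((coord (e i' i)).@[w 0] / (coord (e i i)).@[w 0]) *: chart_point i w.
  apply/rowP => j; rewrite !mxE mulrAC [_ * (coord (e i j)).@[_]]mulrC closure_cross //.
  by rewrite mulfK.
exists ((coord (e i' i)).@[w 0] / (coord (e i i)).@[w 0]) => //.
apply: contraNneq wi' => c0.
by move: wc => /rowP/(_ i'); rewrite c0 scale0r !mxE => ->.
Qed.

End AffineComplement.

(** On the moment curve (1 : t : t^2 : ...) of the dual space, vanishing at a given point
    is a nontrivial polynomial condition on t. *)
Lemma linear_form_avoiding (K : closedFieldType) m (s : seq 'rV[K]_m) :
  exists2 F : {mpoly K[m]}, F \is 1.-homog &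
    forall v, v \in s -> v != 0 -> F.@[v 0] != 0.
Proof.
have /closed_nonrootP[t ht] : \prod_(v <- s | v != 0) rVpoly v != 0.
  rewrite prodf_seq_neq0; apply/allP => v _; apply/implyP.
  by apply: contraNneq => v0; rewrite -[v]rVpolyK v0 raddf0.
exists (\sum_(j < m) t ^+ j *: 'X_j).
  by rewrite rpred_sum // => j _; rewrite rpredZ // dhomogX /= mdeg1.
move=> v vs v0; move: ht; rewrite /root horner_prod prodf_seq_neq0.
move=> /allP/(_ v vs); rewrite v0 /= /rVpoly horner_poly raddf_sum /=.
apply: contraNneq => Fv; apply/eqP; rewrite -[RHS]Fv; apply: eq_bigr => j _.
by rewrite valK mevalZ mevalXU mulrC.
Qed.

(** * The strata of the outer projection *)

Section Strata.
Variables (K : closedFieldType) (n k : nat) (I : {mpoly K[n.+1]} -> Prop).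
Variables (le : rel 'X_{1..n.+1}) (G : seq {mpoly K[n.+1]}).
Hypotheses (k_gt0 : (0 < k)%N) (I_ideal : is_ideal I) (I_homog : homogeneous_ideal I).
Hypothesis center_outside : ~ vanish I (center K n).
Hypotheses (elim_le : elimination_ordering le) (groebG : groebner_basis le I G).
Hypothesis G_homog : forall g, g \in G -> g \is homog mdeg.
Implicit Types (g h : {mpoly K[n.+1]}) (q : 'rV[K]_n) (lam : seq nat).

Lemma GI g : g \in G -> I g.
Proof. by case: groebG => H _; apply: H. Qed.

(** Over q = 0 the line of specialization is the line through the center, so a basis
    element surviving there does not vanish at the center. *)
Lemma nonvanishing_at_center : exists2 e, I e & e.@[center K n 0] != 0.
Proof.
have /hasP[g gG gq] := groebner_nonvanishing I_ideal I_homog elim_le groebG G_homog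
  center_outside (0 : 'rV[K]_n).
exists g; first exact: GI.
have /closed_nonrootP[r] : spec 0 g != 0.
  rewrite -size_poly_gt0 size_spec // size_poly_gt0.
  by apply: contraNneq gq => g0; rewrite /xlc g0 lead_coef0 meval0.
have /homogP[t ht] := G_homog gG.
apply: contraNneq => gc; rewrite /root horner_spec.
rewrite (@meval_eq _ _ _ (fun i => (r *: center K n) 0 i)) => [|i].
  by rewrite (meval_scale _ _ ht) gc mulr0.
by rewrite !mxE eqxx /=; case: unliftP => [j ->|->]; rewrite ?mxE ?eqxx ?mulr1 ?mulr0.
Qed.

Lemma xlc_homog g : g \is homog mdeg -> xlc g \is homog mdeg.
Proof.
move=> /homogP[t /dhomogP hg]; apply/homogP; exists (t - (size (xpoly g)).-1)%N.
apply/dhomogP => m; rewrite mcoeff_msupp /xlc lead_coefE xpoly_mcoeff -mcoeff_msupp => mg.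
have <- : mdeg [multinom if unlift ord0 i is Some j then m j
    else (size (xpoly g)).-1 | i < n.+1] = t by exact: hg.
rewrite [X in (X - _)%N]mdegE big_ord_recl mnmE unlift_none addKn [LHS]mdegE.
by apply: eq_bigr => j _; rewrite mnmE liftK.
Qed.

(** The same basis element governs which leading coefficients vanish at q and the
    divisor of the fiber. *)
Lemma fiber_data q : q != 0 -> exists g,
  [/\ g \in G, (xlc g).@[q 0] != 0,
      forall h, h \in G -> (xlc h).@[q 0] != 0 -> (size (xpoly g) <= size (xpoly h))%N,
      forall f, I f -> spec q g %| spec q f
    & forall lam, all (leq 1) lam ->
       (exists pts, @fiber_eq_divisor K n I q lam pts) <-> root_type lam (spec q g)].
Proof.
move=> q0; have [g [gG gq g_min g_gen]] :=
  fiber_generator I_ideal I_homog elim_le groebG G_homog center_outside q.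
exists g; split=> // lam lam1; apply: fiber_divisor_root_type => //.
- exact: GI.
- exact: G_homog.
- rewrite -size_poly_gt0 size_spec // size_poly_gt0.
  by apply: contraNneq gq => g0; rewrite /xlc g0 lead_coef0 meval0.
- exact: nonvanishing_at_center.
Qed.

Lemma Zlen_generator q : Zlen I k q -> exists g,
  [/\ g \in G, (xlc g).@[q 0] != 0, size (xpoly g) = k.+1
    & forall h, h \in G -> (size (xpoly h) <= k)%N -> (xlc h).@[q 0] = 0].
Proof.
case=> -[q0 _] [lam [lam1 lamk] Hpts].
have [g [gG gq g_min _ /(_ lam lam1)[/(_ Hpts) rt _]]] := fiber_data q0.
have sg : size (xpoly g) = k.+1 by rewrite -(size_spec gq) (size_root_type rt) lamk.
exists g; split=> // h hG hk; apply/eqP; apply: contraT => hq.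
by have := leq_trans (g_min _ hG hq) hk; rewrite sg ltnn.
Qed.

(** A fiber of positive length has a point, so that q lies in the image. *)
Lemma Zlen_intro q g : q != 0 -> g \in G -> size (xpoly g) = k.+1 ->
  (xlc g).@[q 0] != 0 ->
  (forall h, h \in G -> (size (xpoly h) <= k)%N -> (xlc h).@[q 0] = 0) -> Zlen I k q.
Proof.
move=> q0 gG sg gq low; have [g' [gG' gq' g_min g_gen Hlam]] := fiber_data q0.
have sg' : size (xpoly g') = k.+1.
  apply/eqP; rewrite eqn_leq -{1}sg g_min //= ltnNge.
  by apply: contra gq' => /(low _ gG')->.
have ss : size (spec q g') = k.+1 by rewrite size_spec.
have sp0 : spec q g' != 0 by rewrite -size_poly_gt0 ss.
split.
  split=> //; have /closed_rootP[r rr] : size (spec q g') != 1%N.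
    by rewrite ss eqSS -lt0n.
  pose v : 'rV[K]_n.+1 := \row_i (if unlift ord0 i is Some j then q 0 j else r).
  have pv : projection v = q by apply/rowP => j; rewrite !mxE liftK.
  exists v; last by exists 1; rewrite ?oner_eq0 // pv scale1r.
  split.
    by apply: contraNneq q0 => v0; rewrite -pv v0; apply/eqP/rowP => j; rewrite !mxE.
  move=> f /g_gen dv; have : root (spec q f) r by rewrite -dvdp_XsubCl (dvdp_trans _ dv) ?dvdp_XsubCl.
  by rewrite /root horner_spec => /eqP <-; apply: meval_eq => i; rewrite mxE.
have [lam [lam1 lamk] rt] := root_type_exists sp0.
exists lam; last exact/Hlam.
by split=> //; rewrite lamk ss.
Qed.

Definition low_lc (f : {mpoly K[n]}) :=
  exists h, [/\ h \in G, (size (xpoly h) <= k)%N & f = xlc h].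

Lemma x0partP g : reflect (g \in G /\ size (xpoly g) = k.+1) (g \in x0part G k).
Proof.
rewrite /x0part mem_filter xpolyE andbC.
by apply: (iffP andP) => -[gG /eqP sg]; split.
Qed.

Lemma DsetE g q : g \in x0part G k ->
  Dset I k g q <-> vanish low_lc q /\ (xlc g).@[q 0] != 0.
Proof.
move=> /x0partP[gG sg]; rewrite xlcE; split=> [[Zq gq]|[[q0 low] gq]].
  have [_ [_ _ _ low]] := Zlen_generator Zq; split=> //.
  by split=> [|f [h [hG hk ->]]]; [case: Zq => -[] | exact: low].
split=> //; apply: (Zlen_intro q0 gG sg); first by rewrite xlcE.
by move=> h hG hk; apply: low; exists h.
Qed.

Lemma low_lc_homog f : low_lc f -> f \is homog mdeg.
Proof. by case=> h [hG _ ->]; apply/xlc_homog/G_homog. Qed.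

Lemma Dset_open g : g \in x0part G k -> open_in (Zlen I k) (Dset I k g).
Proof.
move=> /x0partP[gG _]; exists (vanish (fun f => f = x0lc g)).
  exists (fun f => f = x0lc g); split=> // _ ->.
  by rewrite -xlcE; apply/xlc_homog/G_homog.
move=> v; split=> -[Zv gv]; split=> //.
  by case=> _ /(_ _ erefl) g0; rewrite g0 eqxx in gv.
apply/eqP => g0; apply: gv; split; first by case: Zv => -[].
by move=> _ ->.
Qed.

(** D_g is the complement of the hypersurface LC(g) = 0 in a closed set.  If LC(g) is
    constant, but there are finitely many points, a linear form avoiding them takes the
    place of LC(g). *)
Lemma Dset_affine g : g \in x0part G k ->
  (1 < msize (x0lc g))%N \/ proj_finite (Zlen I k) -> affine_variety (Dset I k g).
Proof.
move=> gP; have /x0partP[gG sg] := gP; have hg := xlc_homog (G_homog gG).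
have [m1 _|m1 fin] := ltnP 1 (msize (x0lc g)).
  apply: (@affine_complement K n (msize (xlc g)).-1 low_lc (xlc g)).
  - exact: low_lc_homog.
  - by rewrite -homog_msize.
  - by rewrite xlcE -subn1 subn_gt0.
  by move=> v; apply: DsetE.
case: fin => [//|[s hs]].
have [F hF Fs] := linear_form_avoiding s.
apply: (@affine_complement K n 1 low_lc F) => //; first exact: low_lc_homog.
move=> v; split=> [Dv|[Av _]].
  have /(DsetE _ gP)[Av _] := Dv; split=> //.
  case: Dv => /hs[u us [c c0 vE]] _; rewrite vE (meval_scale _ _ hF).
  rewrite mulf_neq0 ?expf_neq0 // Fs //; case: Av => v0 _.
  by apply: contraNneq v0 => u0; rewrite vE u0 scaler0.
apply/(DsetE _ gP); split=> //; have := m1; rewrite -xlcE.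
move=> /msize1_polyC lcE; rewrite lcE mevalC; apply: contra_eq_neq sg => lc0.
have : xlc g = 0 by rewrite lcE lc0.
by move=> /eqP; rewrite lead_coef_eq0 => /eqP->; rewrite size_poly0.
Qed.

Lemma Dset_cover q : Zlen I k q <-> exists2 g, g \in x0part G k & Dset I k g q.
Proof.
split=> [Zq|[g _ []]] //; have [g [gG gq sg _]] := Zlen_generator Zq.
by exists g; [exact/x0partP | split; rewrite // -xlcE].
Qed.

Lemma Zpart_restriction g q lam (y : {mpoly K[n]}) :
  g \in x0part G k -> Dset I k g q -> is_partition lam k -> y.@[q 0] != 0 ->
  Zpart I lam q <-> Xpart lam (restriction k y q g).
Proof.
move=> gP [Zq]; rewrite -xlcE => gq lamP y0; have /x0partP[gG sg] := gP.
have [[q0 imq] _] := Zq; have [lam1 _] := lamP.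
have [g' [gG' gq' g_min g_gen Hlam]] := fiber_data q0.
have [_ [_ _ _ low]] := Zlen_generator Zq.
have sg' : size (xpoly g') = k.+1.
  apply/eqP; rewrite eqn_leq -{1}sg g_min //= ltnNge.
  by apply: contra gq' => /(low _ gG')->.
(* Both generate the fiber, having the same degree. *)
have gg' : spec q g' %= spec q g.
  by rewrite -(dvdp_size_eqp (g_gen _ (GI gG))) !size_spec // sg sg'.
have [c c0 resE] := dehom_restriction y0 (G_homog gG) sg.
have res0 : restriction k y q g 0 ord0 != 0.
  rewrite restrictionE -?xpolyE // ?(G_homog gG) // subn0 mulf_neq0 //.
    by rewrite -[k]/(k.+1.-1) -sg -lead_coefE.
  by rewrite invr_eq0 expf_neq0.
rewrite (XpartE lamP res0) resE.
have -> : Zpart I lam q <-> root_type lam (spec q g').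
  by split=> [[_ /(Hlam _ lam1)]|/(Hlam _ lam1)] //; split.
rewrite (root_type_scaleE lam (spec q g') y0).
have e : spec q g' \Po (y.@[q 0] *: 'X) %= c *: (spec q g \Po (y.@[q 0] *: 'X)).
  have /eqpf_eq[b b0 ->] := gg'; rewrite comp_polyZ.
  by rewrite (eqp_ltrans (eqp_scale _ b0)) eqp_sym eqp_scale.
by split; apply: root_type_eqp; rewrite // eqp_sym.
Qed.

End Strata.

(* Affineness: if LC_{x_0}(g) is a nonzero constant, then D_g = Z_k° is closed in
   P^(n-1), hence not affine unless it is finite.  This does occur: for the
   hyperplane V(x_0), G = {x_0}, k = 1, D_g is the whole P^(n-1). *)
Theorem corollary2p4 (K : closedFieldType) (n k : nat)
    (I : {mpoly K[n.+1]} -> Prop)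
    (le : rel 'X_{1..n.+1}) (G : seq {mpoly K[n.+1]}) :
  [pchar K] =i pred0 -> (0 < n)%N -> (0 < k)%N ->
  is_ideal I -> homogeneous_ideal I -> saturated I ->
  ~ vanish I (center K n) ->
  elimination_ordering le -> groebner_basis le I G ->
  (forall g, g \in G -> g \is homog mdeg) ->
  [/\ forall g, g \in x0part G k -> open_in (Zlen I k) (Dset I k g),
      forall g, g \in x0part G k ->
        (1 < msize (x0lc g))%N \/ proj_finite (Zlen I k) ->
        affine_variety (Dset I k g),
      forall q, Zlen I k q <-> exists2 g, g \in x0part G k & Dset I k g q &
      forall g (q : 'rV[K]_n) (lam : seq nat) (y : {mpoly K[n]}),
        g \in x0part G k -> Dset I k g q -> is_partition lam k ->
        y \is 1.-homog -> y.@[q 0] != 0 ->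
        (Zpart I lam q <-> Xpart lam (restriction k y q g))].
Proof.
move=> _ _ k_gt0 I_ideal I_homog _ center_outside elim_le groebG G_homog; split.
- by move=> g; apply: (Dset_open I G_homog).
- move=> g; exact: (Dset_affine k_gt0 I_ideal I_homog center_outside elim_le groebG G_homog).
- exact: (Dset_cover _ I_ideal I_homog center_outside elim_le groebG G_homog).
move=> g q lam y gP Dq lamP _.
exact: (Zpart_restriction I_ideal I_homog center_outside elim_le groebG G_homog gP Dq lamP).
Qed.
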